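(* Let $q>0$ be fixed. Suppose that $\psi$, $\phi$ and $P_0$ satisfy the following. (A) There exist functions $IF_j(\cdot;\hat P)$, $j=1,2,3$, and $R_n=O_p(n^{-2})$ such that: (A1) $\left|\psi(\hat{P}L)-\psi(\hat{P})-\sum_{j=1}^3\frac{1}{j!}E_{\Delta}IF_{j}(K_{1},\dots,K_{j};\hat{P})\right|\leq R_n$ for all likelihood ratios $L$ with $\hat{E}[\phi(L)]\leq\frac{q}{2n}$, where under $E_\Delta$ the variables $K_1,K_2,\dots$ are i.i.d. from the signed measure $\hat PL-\hat P$ (integration against the product signed measure); (A2) for every $1\le m\le 5$, $\hat E|IF_1(K_1;\hat P)|^m=O_p(1)$, $\hat E|IF_2(K_1,K_2;\hat P)|^m=O_p(1)$, $\hat E|IF_3(K_1,K_2,K_3;\hat P)|^m=O_p(1)$, and $1/\widehat{Var}(IF_1(K_1;\hat P))=O_p(1)$, where $K_1,K_2,\dots$ are i.i.d. from $\hat P$; (A3) for $i=1,2,3$, $IF_i(K_1,\dots,K_i;\hat P)$ is permutation invariant in $K_1,\dots,K_i$ and $E_{K_j\sim\hat P}IF_i(K_1,\dots,K_i;\hat P)=0$ for $j=1,\dots,i$ (the other arguments being held fixed). (B) $\phi$ is convex, $\phi(1)=\phi'(1)=0$, $\phi''(1)>0$, $\phi$ has a continuous fifth-order derivative on $(0,\infty)$, and there is $\delta_0>0$ such that $\phi''(x)>\delta_0$ for $x\in[c_0,C_0]$, where $[c_0,C_0]$ is the range where $\phi(x)\le q/2$. Then the maximum value of the problem $$\max_L\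 \psi(\hat PL)\quad\text{subject to}\quad \hat E[\phi(L)]\le\frac{q}{2n},\quad \hat E L=1$$ admits the expansion $$\begin{aligned} &\psi(\hat{P})+n^{-1/2}\sqrt{\frac{q\hat{\kappa}_{2}}{\phi''(1)}}+\frac{n^{-1}q}{\phi''(1)\hat{\kappa}_2}\left(-\frac{1}{6}\frac{\phi'''(1)\hat{\gamma}}{\phi''(1)}+\frac{1}{2}\hat{\mu}_{2,c}\right)\\ &+\frac{n^{-3/2}q^{3/2}}{\phi''(1)^{3/2}\hat{\kappa}_{2}^{3/2}}\Bigg[\frac{1}{6}\hat{\mu}_{3,c}-\frac{1}{2}\frac{\phi'''(1)}{\phi''(1)}\hat{\mu}_{2,b}+\frac{\phi'''(1)}{3\hat{\kappa}_{2}\phi''(1)}\hat{\gamma}\hat{\mu}_{2,c}+\left(\frac{\phi'''(1)^{2}}{8\phi''(1)^{2}}-\frac{1}{24}\frac{\phi^{(4)}(1)}{\phi''(1)}\right)\hat{\mu}_{4}\\ &\qquad+\frac{1}{2}\hat{\mu}_{2,a}-\frac{\phi'''(1)^{2}}{18\phi''(1)^{2}\hat{\kappa}_{2}}\hat{\gamma}^{2}-\frac{\phi'''(1)^{2}}{8\phi''(1)^{2}}\hat{\kappa}_{2}^{2}-\frac{1}{2\hat{\kappa}_{2}}\hat{\mu}_{2,c}^{2}\Bigg]+O_{p}(n^{-2}). \end{aligned}$$ The minimum value of $\psi(\hat PL)$ under the same constraints has the same expansion, but with a negation on the coefficients of $n^{-1/2}$ and $n^{-3/2}$.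
   Context: $X_1,X_2,\dots,X_n$ are i.i.d. from an unknown distribution $P_0$ and $\hat P=\frac1n\sum_{i=1}^n\delta_{X_i}$ is the empirical distribution. $\hat E$ and $\widehat{Var}$ denote expectation and variance under $\hat P$ (for several variables, under i.i.d. draws from $\hat P$). $\psi$ is a real-valued functional of probability distributions and $\phi:\mathbb R_+\to\mathbb R$. A likelihood ratio $L=dP/d\hat P$, for $P$ absolutely continuous with respect to $\hat P$, is identified with the nonnegative vector $(L(X_1),\dots,L(X_n))$, so $\hat E L=1$; $\hat PL$ is the distribution putting mass $L(X_i)/n$ at $X_i$, and $\hat E[\phi(L)]=\frac1n\sum_i\phi(L(X_i))$. Stochastic orders $O_p$ are as $n\to\infty$ under $P_0$. With $X,Y,Z$ i.i.d. from $\hat P$: $\hat{\kappa}_{2}=\hat{E}IF_{1}^{2}(X;\hat{P})$, $\hat{\gamma}=\hat{E}IF_{1}^{3}(X;\hat{P})$, $\hat{\mu}_{4}=\hat{E}IF_{1}^{4}(X;\hat{P})$, $\hat{\mu}_{2,a}=\hat{E}[IF_{1}(X;\hat{P})IF_{1}(Z;\hat{P})IF_{2}(X,Y;\hat{P})IF_{2}(Y,Z;\hat{P})]$, $\hat{\mu}_{2,b}=\hat{E}[IF_{1}(X;\hat{P})IF_{1}(Y;\hat{P})^{2}IF_{2}(X,Y;\hat{P})]$, $\hat{\mu}_{2,c}=\hat{E}[IF_{1}(X;\hat{P})IF_{1}(Y;\hat{P})IF_{2}(X,Y;\hat{P})]$, $\hat{\mu}_{3,c}=\hat{E}[IF_{1}(X;\hat{P})IF_{1}(Y;\hat{P})IF_{1}(Z;\hat{P})IF_{3}(X,Y,Z;\hat{P})]$.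 *)

(* Defs.v *)
From HB Require Import structures.
From mathcomp Require Import all_boot all_order all_algebra.
From mathcomp Require Import finmap.
From mathcomp Require Import all_classical all_reals all_analysis.

Set Implicit Arguments.
Unset Strict Implicit.
Unset Printing Implicit Defensive.

Import Order.TTheory GRing.Theory Num.Theory.
Import numFieldNormedType.Exports.

Local Open Scope classical_set_scope.
Local Open Scope ring_scope.

Section iid.
Context d d' (Omega : measurableType d) (T : measurableType d') (R : realType).
Variable P : probability Omega R.

Definition mutually_independent (X : nat -> {RV P >-> T}) : Prop :=
  forall (J : {fset nat}) (A : nat -> set T), (forall i, measurable (A i)) ->
    P (\bigcap_(i in [set` J]) (X i @^-1` A i)) =
    (\prod_(i <- J) P (X i @^-1` A i))%E.

Definition iid (P0 : probability T R) (X : nat -> {RV P >-> T}) : Prop :=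
  mutually_independent X /\
  forall i A, measurable A -> distribution P (X i) A = P0 A.

(* Y = O_p(r), where P^* is the outer measure of P: for measurable Y n this is
   the usual notion, and no measurability has to be known, in particular for
   the optimal values. Y is extended-real valued so that 1 / 0 = +oo. *)
Definition bigOp (Y : nat -> Omega -> \bar R) (r : nat -> R) : Prop :=
  forall e : R, 0 < e -> exists M : R, \forall n \near \oo,
    ((P^*)%mu [set w | ((M * r n)%:E < `|Y n w|)%E] <= e%:E)%E.

End iid.

Section likelihood_ratio.
Context (R : realType).

Definition avg n (a : 'I_n -> R) : R := n%:R^-1 * \sum_(i < n) a i.

(* dP/dPhat as the vector of its values at the n sample points *)
Record lratio (n : nat) := LRatio {
  lr :> 'I_n -> R ;
  lr_ge0 : forall i, 0 <= lr i ;
  lr_avg : avg lr = 1 }.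

Lemma lratio1_ge0 n (i : 'I_n.+1) : (0 : R) <= 1.
Proof. exact: ler01. Qed.

Lemma lratio1_avg n : avg (fun _ : 'I_n.+1 => 1 : R) = 1.
Proof. by rewrite /avg sumr_const card_ord mulVf// pnatr_eq0. Qed.

Definition lratio1 n : lratio n.+1 := LRatio (@lratio1_ge0 n) (lratio1_avg n).

Context d (T : measurableType d) (n : nat) (x : 'I_n -> T).

(* Phat L, for Phat the empirical distribution of the points x i *)
Definition tilt (L : lratio n) (A : set T) : \bar R :=
  (\sum_(i < n) (L i / n%:R)%:E * \d_(x i) A)%E.

Section tilt_probability.
Variable L : lratio n.

Let w_ge0 i : (0 <= (L i / n%:R)%:E)%E.
Proof. by rewrite lee_fin divr_ge0// lr_ge0. Qed.

Let tilt0 : tilt L set0 = 0%E.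
Proof. by rewrite /tilt big1// => i _; rewrite measure0 mule0. Qed.

Let tilt_ge0 A : (0 <= tilt L A)%E.
Proof. by apply: sume_ge0 => i _; rewrite mule_ge0. Qed.

Let tilt_sigma_additive : semi_sigma_additive (tilt L).
Proof.
move=> F mF tF mUF.
have -> : tilt L = msum (fun k => if insub k is Some i then
    mscale (NngNum (divr_ge0 (lr_ge0 L i) (ler0n R n))) \d_(x i)
    else mzero) n.
  apply/funext => A; apply: eq_bigr => i _.
  by rewrite valK /mscale.
exact: measure_semi_sigma_additive.
Qed.

HB.instance Definition _ := isMeasure.Build _ _ _ (tilt L)
  tilt0 tilt_ge0 tilt_sigma_additive.

Let tilt_setT : tilt L [set: T] = 1%E.
Proof.
rewrite /tilt; under eq_bigr do rewrite diracT mule1.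
by rewrite sumEFin -mulr_suml mulrC -/(avg L) lr_avg.
Qed.

HB.instance Definition _ := Measure_isProbability.Build _ _ _
  (tilt L) tilt_setT.

End tilt_probability.

Definition tiltP (L : lratio n) : probability T R := tilt L.

(* Expectation under Phat and integral against the signed measure Phat L - Phat;
   expectations over several i.i.d. arguments are iterated ones. *)
Definition Ehat (f : T -> R) : R := avg (fun i => f (x i)).

Definition Edelta (L : lratio n) (f : T -> R) : R :=
  avg (fun i => (L i - 1) * f (x i)).

Definition Varhat (f : T -> R) : R := Ehat (fun k => (f k - Ehat f) ^+ 2).

End likelihood_ratio.

Definition empirical (R : realType) d (T : measurableType d) n
  (x : 'I_n.+1 -> T) : probability T R := tiltP x (lratio1 R n).

Section expansion.
Context (R : realType) d (T : measurableType d) (n : nat) (x : 'I_n -> T).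
Variables (IF1 : T -> R) (IF2 : T -> T -> R) (IF3 : T -> T -> T -> R).

Let E := @Ehat R _ T n x.

Definition kappa2 : R := E (fun a => IF1 a ^+ 2).
Definition gammahat : R := E (fun a => IF1 a ^+ 3).
Definition mu4 : R := E (fun a => IF1 a ^+ 4).
Definition mu2a : R :=
  E (fun a => E (fun b => E (fun c => IF1 a * IF1 c * IF2 a b * IF2 b c))).
Definition mu2b : R :=
  E (fun a => E (fun b => IF1 a * IF1 b ^+ 2 * IF2 a b)).
Definition mu2c : R :=
  E (fun a => E (fun b => IF1 a * IF1 b * IF2 a b)).
Definition mu3c : R :=
  E (fun a => E (fun b => E (fun c => IF1 a * IF1 b * IF1 c * IF3 a b c))).

Variables (phi : R -> R) (q : R).

Let p2 : R := derive1n 2 phi 1.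
Let p3 : R := derive1n 3 phi 1.
Let p4 : R := derive1n 4 phi 1.

(* The terms of order n^(-1/2), n^(-1), n^(-3/2), including these powers of n;
   on kappa2 = 0 division gives 0, an event whose probability tends to 0 when
   1 / kappa2 = O_p(1). *)
Definition term1 : R :=
  n%:R `^ (- (1 / 2)) * Num.sqrt (q * kappa2 / p2).

Definition term2 : R :=
  n%:R^-1 * q / (p2 * kappa2) *
  (- (1 / 6) * (p3 * gammahat / p2) + 1 / 2 * mu2c).

Definition term3 : R :=
  n%:R `^ (- (3 / 2)) * q `^ (3 / 2) / (p2 `^ (3 / 2) * kappa2 `^ (3 / 2)) *
  (1 / 6 * mu3c
   - 1 / 2 * (p3 / p2) * mu2b
   + p3 / (3 * kappa2 * p2) * gammahat * mu2c
   + (p3 ^+ 2 / (8 * p2 ^+ 2) - 1 / 24 * (p4 / p2)) * mu4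
   + 1 / 2 * mu2a
   - p3 ^+ 2 / (18 * p2 ^+ 2 * kappa2) * gammahat ^+ 2
   - p3 ^+ 2 / (8 * p2 ^+ 2) * kappa2 ^+ 2
   - 1 / (2 * kappa2) * mu2c ^+ 2).

End expansion.

Section optimal_values.
Context (R : realType) d (T : measurableType d) (n : nat) (x : 'I_n -> T).
Variables (psi : probability T R -> R) (phi : R -> R) (q : R).

Definition feasible : set (lratio R n) :=
  [set L : lratio R n | avg (fun i => phi (L i)) <= q / (2 * n%:R)].

Definition max_value : \bar R :=
  ereal_sup [set (psi (tiltP x L))%:E | L in feasible].

Definition min_value : \bar R :=
  ereal_inf [set (psi (tiltP x L))%:E | L in feasible].

End optimal_values.

(* Main.v *)
(* Write Delta = L - 1 and keep the three terms of (A1): what is left is to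
   maximize a cubic polynomial G(Delta) under avg phi (1 + Delta) <= q / (2 n)
   and avg Delta = 0. With f = IF1, g(a) = avg_b IF2(a, b) f(b), rho = phi'''(1) / phi''(1)
   and kappa = avg f^2, the point
     y = delta f + delta^2 (g - rho / 2 (f^2 - kappa))
   is stationary for the Lagrangian with multiplier alpha = 1 / (phi''(1) delta),
   up to a gradient whose mean square is O(n^(-3/2)). As alpha is of order sqrt n
   while phi is strongly convex on the feasible range, the Lagrangian is strongly
   concave there, so by weak duality no feasible point beats G(y) by more than
   O(n^(-2)), provided that delta = n^(-1/2) (c + d1 n^(-1/2) + d2 n^(-1)) is such
   that the constraint is an equality at y up to O(n^(-5/2)). Conversely, shrinking y
   by a factor 1 - O(n^(-3/2)) makes it feasible, by convexity. Expanding G(y) gives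
   the coefficients. The minimum is the maximum for (- IF1, - IF2, - IF3). All this
   is deterministic on an event where the moments are bounded; only sup |delta f| and
   sup |delta g| -> 0 (from fourth moments) and the fifth moment of f are needed. *)
Require Import Defs.
From HB Require Import structures.
From mathcomp Require Import all_boot all_order all_algebra.
From mathcomp Require Import all_classical all_reals all_analysis.
From mathcomp Require Import ring lra.
Import Order.TTheory GRing.Theory Num.Theory.
Import numFieldNormedType.Exports.
Local Open Scope classical_set_scope.
Local Open Scope ring_scope.

Set Implicit Arguments.
Unset Strict Implicit.
Unset Printing Implicit Defensive.

(** * Averages and multilinear forms *)

(** Second order in [y] is enough for an expansion to third order because gradient errors count
    quadratically: weak duality charges their mean square divided by alpha, and n^(-3/2) / n^(1/2) =
    n^(-2). It also spares any existence argument for an optimal L. The obstacle is integrability.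
    The functions f and g are not bounded uniformly in n, so a Taylor term can be kept only if it is
    dominated by |f|^5 and by the fourth power of g. The conditions delta |f| <= 1 and delta |g +
    rho kappa / 2| <= 1 convert higher powers of f and g into powers of delta, and this is what
    limits the gradient's mean square to n^(-3/2). Randomness is separated from analysis: for each
    tolerance there are events, with complements of outer measure at most the tolerance, on which
    one constant bounds all moments. The asymptotics run along a filter on pairs of a sample size
    and a sample point, which makes every constant uniform over these events. *)

Section average.
Context (R : realType) (m : nat).
Implicit Types (f g h : 'I_m.+1 -> R) (a : R).

Lemma eq_avg f g : (forall i, f i = g i) -> avg f = avg g.
Proof. by move=> fg; congr avg; apply/funext. Qed.

Lemma avgD f g : avg (fun i => f i + g i) = avg f + avg g.
Proof. by rewrite /avg big_split mulrDr. Qed.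

Lemma avgZ a f : avg (fun i => a * f i) = a * avg f.
Proof. by rewrite /avg -mulr_sumr mulrCA. Qed.

Lemma avgB f g : avg (fun i => f i - g i) = avg f - avg g.
Proof. by rewrite /avg sumrB mulrBr. Qed.

Lemma avg_cst a : avg (fun _ : 'I_m.+1 => a) = a.
Proof.
by rewrite /avg sumr_const card_ord -(mulr_natl a) mulrA mulVf ?mul1r// pnatr_eq0.
Qed.

Lemma exchange_avg (F : 'I_m.+1 -> 'I_m.+1 -> R) :
  avg (fun i => avg (fun j => F i j)) = avg (fun j => avg (fun i => F i j)).
Proof.
rewrite /avg; congr (_ * _).
under eq_bigr do rewrite mulr_sumr.
by rewrite exchange_big; apply: eq_bigr => j _; rewrite mulr_sumr.
Qed.

Lemma ler_avg f g : (forall i, f i <= g i) -> avg f <= avg g.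
Proof.
by move=> fg; rewrite /avg ler_wpM2l ?invr_ge0 ?ler0n// ler_sum.
Qed.

Lemma avg_ge0 f : (forall i, 0 <= f i) -> 0 <= avg f.
Proof. by move=> f0; rewrite -(avg_cst 0) ler_avg. Qed.

Lemma ler_norm_avg f : `|avg f| <= avg (fun i => `|f i|).
Proof.
rewrite /avg normrM ger0_norm ?invr_ge0 ?ler0n//.
by rewrite ler_wpM2l ?invr_ge0 ?ler0n// ler_norm_sum.
Qed.

Lemma ler_term_avg f i : (forall j, 0 <= f j) -> f i <= m.+1%:R * avg f.
Proof.
move=> f0; rewrite /avg mulrA mulfV ?pnatr_eq0// mul1r (bigD1 i)//=.
by rewrite lerDl sumr_ge0.
Qed.

Lemma avg_sqr_eq0 f : avg (fun i => f i ^+ 2) = 0 -> forall i, f i = 0.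
Proof.
move=> f0 i; have := @ler_term_avg (fun j => f j ^+ 2) i.
rewrite f0 mulr0 => /(_ (fun j => sqr_ge0 _)) fi0.
by apply/eqP; rewrite -sqrf_eq0 eq_le fi0 sqr_ge0.
Qed.

Lemma avg_cauchy_schwarz f g :
  avg (fun i => f i * g i) ^+ 2 <=
  avg (fun i => f i ^+ 2) * avg (fun i => g i ^+ 2).
Proof.
set a := avg (fun i => g i ^+ 2); set b := avg (fun i => f i * g i).
have a0 : 0 <= a by apply: avg_ge0 => i; exact: sqr_ge0.
(* If [a] vanishes, so does every value of [g]; otherwise expand the nonnegative average of (a f - b
   g)^2 and cancel one factor [a]. *)
have [a0'|aN0] := eqVneq a 0.
  have g0 := avg_sqr_eq0 a0'.
  rewrite /b (@eq_avg _ (fun=> 0) _) ?avg_cst ?a0' ?mulr0 ?expr0n//.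
  by move=> i; rewrite g0 mulr0.
have : 0 <= avg (fun i => (a * f i - b * g i) ^+ 2).
  by apply: avg_ge0 => i; exact: sqr_ge0.
rewrite (@eq_avg _ (fun i => a ^+ 2 * (f i ^+ 2) + ((- 2 * a * b) * (f i * g i)
   + b ^+ 2 * g i ^+ 2))); last by move=> i; ring.
rewrite !avgD !avgZ -/a -/b => H.
have {H} : 0 <= a * (avg (fun i => f i ^+ 2) * a - b ^+ 2).
  by apply: le_trans H _; rewrite le_eqVlt; apply/orP; left; apply/eqP; ring.
by rewrite pmulr_rge0 ?lt0r ?aN0// subr_ge0.
Qed.

Lemma avg_sqr_le f : avg f ^+ 2 <= avg (fun i => f i ^+ 2).
Proof.
have := avg_cauchy_schwarz f (fun=> 1).
rewrite (@eq_avg (fun i => f i * 1) f); last by move=> i; rewrite mulr1.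
by rewrite avg_cst expr1n mulr1.
Qed.

End average.

(* Otherwise rewriting unfolds [avg] in search of products. *)
Opaque avg.

Section multilinear.
Context (R : realType) (m : nat).
Variables (f : 'I_m.+1 -> R) (F2 : 'I_m.+1 -> 'I_m.+1 -> R).
Variable F3 : 'I_m.+1 -> 'I_m.+1 -> 'I_m.+1 -> R.
Implicit Types (u v w h : 'I_m.+1 -> R).

Definition op2 v i := avg (fun j => v j * F2 i j).
Definition op3 u v i := avg (fun j => u j * avg (fun k => v k * F3 i j k)).
Definition form2 u v := avg (fun i => u i * op2 v i).
Definition form3 u v w := avg (fun i => u i * op3 v w i).

(** For [v = L - 1] this is convertible to the nested [Edelta] sum of (A1), so that hypothesis
    applies to it as it stands. *)
Definition cubic_expansion v :=
  avg (fun i => v i * f i) + 1 / 2 * form2 v v + 1 / 6 * form3 v v v.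

Let A2 := avg (fun i => avg (fun j => F2 i j ^+ 2)).
Let A3 := avg (fun i => avg (fun j => avg (fun k => F3 i j k ^+ 2))).

Lemma op2_lin a b u v i :
  op2 (fun j => a * u j + b * v j) i = a * op2 u i + b * op2 v i.
Proof. by rewrite /op2 -!avgZ -avgD; apply: eq_avg => j; ring. Qed.

(** The Hilbert-Schmidt norm of a kernel bounds its operator norm: Cauchy-Schwarz in the integrated
    argument, for each fixed [i]. The next three bounds repeat this argument. *)
Lemma op2_sqr_le v :
  avg (fun i => op2 v i ^+ 2) <= A2 * avg (fun i => v i ^+ 2).
Proof.
rewrite mulrC -avgZ; apply: ler_avg => i; exact: avg_cauchy_schwarz.
Qed.

Lemma op3_sqr_le u v : avg (fun i => op3 u v i ^+ 2) <=
  A3 * (avg (fun i => u i ^+ 2) * avg (fun i => v i ^+ 2)).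
Proof.
rewrite mulrC -(avgZ (_ * _)); apply: ler_avg => i.
apply: le_trans (avg_cauchy_schwarz _ _) _.
rewrite -mulrA ler_wpM2l//; first by apply: avg_ge0 => j; exact: sqr_ge0.
rewrite -avgZ; apply: ler_avg => j; exact: avg_cauchy_schwarz.
Qed.

Lemma form2_sqr_le u v : form2 u v ^+ 2 <=
  A2 * (avg (fun i => u i ^+ 2) * avg (fun i => v i ^+ 2)).
Proof.
apply: le_trans (avg_cauchy_schwarz _ _) _.
rewrite [leRHS]mulrCA ler_wpM2l ?op2_sqr_le//.
by apply: avg_ge0 => j; exact: sqr_ge0.
Qed.

Lemma form3_sqr_le u v w : form3 u v w ^+ 2 <=
  A3 * (avg (fun i => u i ^+ 2) *
    (avg (fun i => v i ^+ 2) * avg (fun i => w i ^+ 2))).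
Proof.
apply: le_trans (avg_cauchy_schwarz _ _) _.
rewrite [leRHS]mulrCA ler_wpM2l ?op3_sqr_le//.
by apply: avg_ge0 => j; exact: sqr_ge0.
Qed.

Hypothesis F2C : forall i j, F2 j i = F2 i j.
Hypothesis F3C12 : forall i j k, F3 j i k = F3 i j k.
Hypothesis F3C23 : forall i j k, F3 i k j = F3 i j k.

Lemma form2C u v : form2 u v = form2 v u.
Proof.
transitivity (avg (fun i => avg (fun j => u i * (v j * F2 i j)))).
  by apply: eq_avg => i; rewrite avgZ.
rewrite exchange_avg; apply: eq_avg => j; rewrite -avgZ.
by apply: eq_avg => i; rewrite F2C; ring.
Qed.

Lemma form2_lin a b u v w : form2 (fun j => a * u j + b * v j) w =
  a * form2 u w + b * form2 v w.
Proof. by rewrite /form2 -!avgZ -avgD; apply: eq_avg => j; ring. Qed.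

Lemma form3C23 u v w : form3 u v w = form3 u w v.
Proof.
apply: eq_avg => i; congr (_ * _).
transitivity (avg (fun j => avg (fun k => v j * (w k * F3 i j k)))).
  by apply: eq_avg => j; rewrite avgZ.
rewrite exchange_avg; apply: eq_avg => j; rewrite -avgZ.
by apply: eq_avg => k; rewrite F3C23; ring.
Qed.

Lemma form3C12 u v w : form3 u v w = form3 v u w.
Proof.
transitivity (avg (fun i => avg (fun j =>
    u i * (v j * avg (fun k => w k * F3 i j k))))).
  by apply: eq_avg => i; rewrite avgZ.
rewrite exchange_avg; apply: eq_avg => j; rewrite -avgZ.
apply: eq_avg => i; rewrite mulrCA; congr (_ * (_ * _)).
by apply: eq_avg => k; rewrite F3C12.
Qed.

Lemma form3_lin a b u v w z : form3 (fun j => a * u j + b * v j) w z =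
  a * form3 u w z + b * form3 v w z.
Proof. by rewrite /form3 -!avgZ -avgD; apply: eq_avg => j; ring. Qed.

Lemma form2_diag_lin a b u v :
  form2 (fun j => a * u j + b * v j) (fun j => a * u j + b * v j) =
  a ^+ 2 * form2 u u + 2 * a * b * form2 u v + b ^+ 2 * form2 v v.
Proof.
rewrite form2_lin (form2C u (fun _ => _)) (form2C v (fun _ => _)) !form2_lin.
rewrite (form2C v u); ring.
Qed.

Lemma form3_diag_lin a b u v (s := fun j => a * u j + b * v j) :
  form3 s s s =
  a ^+ 3 * form3 u u u + 3 * a ^+ 2 * b * form3 u u v +
  3 * a * b ^+ 2 * form3 u v v + b ^+ 3 * form3 v v v.
Proof.
have L w z : form3 s w z = a * form3 u w z + b * form3 v w z.
  exact: form3_lin.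
have Lm w z : form3 w s z = a * form3 w u z + b * form3 w v z.
  by rewrite form3C12 L !(form3C12 w).
have Lr w z : form3 w z s = a * form3 w z u + b * form3 w z v.
  by rewrite form3C23 Lm !(form3C23 w z).
rewrite L !Lm !Lr (form3C12 v u u) (form3C23 u v u) (form3C12 v u v).
rewrite (form3C23 v v u) (form3C12 v u v); ring.
Qed.

End multilinear.

(** * Taylor bounds and the divergence phi *)

Section taylor.
Context (R : realType).
Implicit Types (F dF : R -> R) (a b e C : R).

(** Parametrizing the segment by [t] covers a < b, b < a and a = b at once, which frees the Taylor
    and convexity arguments from case distinctions on the side of the base point. *)
Lemma mean_value F dF a b :
  (forall t, 0 <= t <= 1 -> is_derive (a + t * (b - a)) 1 F (dF (a + t * (b - a)))) ->
  exists2 t, 0 <= t <= 1 & F b - F a = dF (a + t * (b - a)) * (b - a).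
Proof.
have key (u v : R) : u < v ->
    (forall x, u <= x <= v -> is_derive x (1 : R) F (dF x)) ->
    exists2 x, u <= x <= v & F v - F u = dF x * (v - u).
  move=> uv dFx; have [||x] := @MVT _ F dF u v uv.
  - by move=> x; rewrite in_itv/= => /andP[ux xv]; apply: dFx; rewrite !ltW.
  - apply: derivable_within_continuous => x.
    by rewrite in_itv/= => /dFx [].
  by rewrite in_itv/= => /andP[ux xv] ->; exists x; rewrite ?ltW.
have [ab|ba|<-] := ltgtP a b => dFt; last first.
- by exists 0; rewrite ?lexx ?ler01// !subrr mulr0.
- have baN0 : b - a != 0 by rewrite subr_eq0 lt_eqF.
  have x01 x : b <= x <= a -> 0 <= (x - a) / (b - a) <= 1.
    move=> /andP[bx xa]; rewrite -(opprB a x) -(opprB a b) invrN mulrNN.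
    by rewrite divr_ge0 ?subr_ge0 ?(ltW ba)//= ler_pdivrMr ?subr_gt0// mul1r lerB.
  have [x /x01 bxa|x bxa Fx] := key b a ba.
    have -> : x = a + (x - a) / (b - a) * (b - a) by rewrite divfK// subrKC.
    exact: dFt.
  exists ((x - a) / (b - a)); first exact: x01.
  by rewrite divfK// subrKC -(opprB (F a)) Fx -mulrN opprB.
- have baN0 : b - a != 0 by rewrite subr_eq0 gt_eqF.
  have x01 x : a <= x <= b -> 0 <= (x - a) / (b - a) <= 1.
    move=> /andP[ax xb].
    by rewrite divr_ge0 ?subr_ge0 ?(ltW ab)//= ler_pdivrMr ?subr_gt0// mul1r lerB.
  have [x /x01 axb|x axb Fx] := key a b ab.
    have -> : x = a + (x - a) / (b - a) * (b - a) by rewrite divfK// subrKC.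
    exact: dFt.
  exists ((x - a) / (b - a)); first exact: x01.
  by rewrite divfK// subrKC.
Qed.

(** Induction on the order: the derivative of the Taylor polynomial of F is the Taylor polynomial of
    F', so the mean value theorem for F - P turns the bound for F' into one for F. This loses the
    factor 1 / n!, which is harmless here. [P] is a formal polynomial so that its derivative can be
    computed algebraically. *)
Lemma taylor_remainder n F a e C :
  (forall k : nat, (k < n)%N -> forall x, `|x - a| <= e ->
     derivable (derive1n k F) x 1) ->
  (forall x, `|x - a| <= e -> `|derive1n n F x| <= C) ->
  forall x, `|x - a| <= e ->
  `|F x - \sum_(k < n) derive1n k F a / k`!%:R * (x - a) ^+ k| <=
  C * `|x - a| ^+ n.
Proof.
elim: n F => [|n IHn] F dF bF x xae.
  by rewrite big_ord0 subr0 expr0 mulr1; exact: bF.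
have IH : forall y, `|y - a| <= e -> `|derive1 F y -
    \sum_(k < n) derive1n k.+1 F a / k`!%:R * (y - a) ^+ k| <= C * `|y - a| ^+ n.
  move=> y yae; under eq_bigr do rewrite /derive1n iterSr.
  apply: IHn => // [k kn z zae|z zae].
    by have := dF k.+1 kn z zae; rewrite /derive1n iterSr.
  by have := bF z zae; rewrite /derive1n iterSr.
pose P : {poly R} :=
  \sum_(k < n.+1) (derive1n k F a / k`!%:R) *: ('X - a%:P) ^+ k.
have PE y : P.[y] = \sum_(k < n.+1) derive1n k F a / k`!%:R * (y - a) ^+ k.
  by rewrite horner_sum; apply: eq_bigr => k _; rewrite !hornerE.
have dPE y : P^`().[y] = \sum_(k < n) derive1n k.+1 F a / k`!%:R * (y - a) ^+ k.
  rewrite /P raddf_sum horner_sum big_ord_recl /= expr0 linearZ/= derivC.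
  rewrite scaler0 horner0 add0r; apply: eq_bigr => k _.
  rewrite linearZ/= /bump/= add1n deriv_exp derivXsubC mul1r !hornerE/= factS.
  rewrite natrM hornerMn !hornerE/= -(mulr_natr (_ ^+ k)) invfM.
  by field; rewrite pnatr_eq0 -lt0n fact_gt0 ?nat1r ?pnatr_eq0.
have Pa : F a = P.[a].
  rewrite PE big_ord_recl/= expr0 mulr1 fact0 divr1 big1 ?addr0// => k _.
  by rewrite /bump/= subrr add1n exprS mul0r mulr0.
have seg t : 0 <= t <= 1 -> `|(a + t * (x - a)) - a| <= `|x - a|.
  move=> /andP[t0 t1].
  by rewrite (addrC a) addrK normrM (ger0_norm t0) ler_piMl.
have [t t01|t t01] := @mean_value (F \- horner P) (fun y => derive1 F y - P^`().[y]) a x.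
  apply: is_deriveB; rewrite derive1E; apply/derivableP.
  exact: (dF 0%N) (le_trans (seg t t01) xae).
rewrite /= Pa subrr subr0 -PE => ->.
rewrite normrM exprSr mulrA ler_wpM2r//.
have dt : `|(a + t * (x - a)) - a| <= e by rewrite (le_trans (seg _ t01)).
rewrite dPE (le_trans (IH _ dt))// ler_wpM2l//.
  by rewrite (le_trans (normr_ge0 _) (bF _ xae)).
by rewrite lerXn2r ?nnegrE//; exact: seg.
Qed.

End taylor.

(* What the expansion needs to know of phi: Taylor bounds near 1, and, on the
   range [phi <= q / 2], strong convexity with respect to points near 1. *)
Record tame_divergence (R : realType) (phi dphi : R -> R)
    (q p p3 p4 eta C dl D : R) : Prop := TameDivergence {
  tame_eta : 0 < eta < 1 ;
  tame_C : 0 <= C ;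
  tame_dl : 0 < dl ;
  tame_taylor : forall y, `|y| <= eta ->
    `|phi (1 + y) - (p / 2 * y ^+ 2 + p3 / 6 * y ^+ 3 + p4 / 24 * y ^+ 4)| <=
    C * `|y| ^+ 5 ;
  tame_taylor' : forall y, `|y| <= eta ->
    `|dphi (1 + y) - (p * y + p3 / 2 * y ^+ 2)| <= C * `|y| ^+ 3 ;
  tame_convex : forall y z, `|y| <= eta -> 0 <= z -> phi z <= q / 2 ->
    phi (1 + y) + dphi (1 + y) * (z - (1 + y)) + dl * (z - (1 + y)) ^+ 2 <=
    phi z ;
  tame_star : forall y t, `|y| <= eta -> 0 <= t <= 1 ->
    phi (1 + t * y) <= t * phi (1 + y) ;
  tame_range : forall z, 0 <= z -> phi z <= q / 2 -> `|z - 1| <= D }.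

Section tame.
Context (R : realType) (phi : R -> R) (q c0 C0 delta0 : R).
Hypothesis q_gt0 : 0 < q.
Hypothesis cvx_phi : convex_function (E := R^o) `[0, +oo[%classic phi.
Hypothesis phi1 : phi 1 = 0.
Hypothesis dphi1 : derive1 phi 1 = 0.
Hypothesis d_phi : forall k : nat, (k < 5)%N -> forall y : R, 0 < y ->
  derivable (derive1n k phi) y 1.
Hypothesis c_phi5 : {for 1, continuous (derive1n 5 phi)}.
Hypothesis delta0_gt0 : 0 < delta0.
Hypothesis range_phi :
  [set y | 0 <= y /\ phi y <= q / 2] = `[c0, C0]%classic.
Hypothesis phi2_gt : forall y : R, c0 <= y <= C0 -> 0 < y ->
  delta0 < derive1n 2 phi y.

Let rangeP (y : R) : (0 <= y /\ phi y <= q / 2) <-> c0 <= y <= C0.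
Proof.
have := congr1 (fun A : set R => A y) range_phi.
by rewrite /= in_itv /= => ->.
Qed.

Let cvx (a b t : R) : 0 <= a -> 0 <= b -> 0 <= t <= 1 ->
  phi (t * a + (1 - t) * b) <= t * phi a + (1 - t) * phi b.
Proof.
move=> a0 b0 /andP[t0 t1].
have := @cvx_phi (Itv01 t0 t1) a b.
by rewrite !inE/= !in_itv/= a0 b0 => /(_ isT isT).
Qed.

Let is_derive_phi k (y : R) : (k < 5)%N -> 0 < y ->
  is_derive y (1 : R) (derive1n k phi) (derive1n k.+1 phi y).
Proof.
by move=> k5 y0; rewrite derive1nS derive1E; exact/derivableP/d_phi.
Qed.

Let taylor_sum5 (c : nat -> R) (y : R) : \sum_(k < 5) c k / k`!%:R * y ^+ k =
  c 0%N + c 1%N * y + c 2%N / 2 * y ^+ 2 + c 3%N / 6 * y ^+ 3 + c 4%N / 24 * y ^+ 4.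
Proof.
rewrite !big_ord_recl big_ord0 /= /bump/= !add1n ?factS ?fact0.
by move: (c 0%N) (c 1%N) (c 2%N) (c 3%N) (c 4%N) => *; field.
Qed.

Let taylor_sum4 (c : nat -> R) (y : R) : \sum_(k < 4) c k / k`!%:R * y ^+ k =
  c 0%N + c 1%N * y + c 2%N / 2 * y ^+ 2 + c 3%N / 6 * y ^+ 3.
Proof.
rewrite !big_ord_recl big_ord0 /= /bump/= !add1n ?factS ?fact0.
by move: (c 0%N) (c 1%N) (c 2%N) (c 3%N) => *; field.
Qed.

(** The mean value theorem for phi - Q, then for phi', shows that the right side exceeds the left by
    (phi''(y) - delta0) t (z - a)^2 with [y] on the segment. Positivity of both ends keeps the
    segment where phi is differentiable. *)
Let strong_convex_gt0 (a z : R) : 0 < a -> 0 < z -> c0 <= a <= C0 -> c0 <= z <= C0 ->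
  phi a + derive1 phi a * (z - a) + delta0 / 2 * (z - a) ^+ 2 <= phi z.
Proof.
move=> a0 z0 /andP[ca aC] /andP[cz zC].
have seg (t u : R) : 0 <= t <= 1 -> 0 < u -> c0 <= u <= C0 ->
    0 < a + t * (u - a) /\ c0 <= a + t * (u - a) <= C0.
  move=> /andP[t0 t1] u0 /andP[cu uC].
  have [tE|tN] := eqVneq t 0; first by rewrite tE mul0r addr0 a0 ca aC.
  have t0' : 0 < t by rewrite lt0r tN.
  have E : a + t * (u - a) = (1 - t) * a + t * u by ring.
  have t10 : 0 <= 1 - t by rewrite subr_ge0.
  rewrite E; split; first by rewrite ltr_wpDl ?mulr_ge0 ?mulr_gt0// ltW.
  have H1 := ler_wpM2l t10 ca; have H2 := ler_wpM2l t0 cu.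
  have H3 := ler_wpM2l t10 aC; have H4 := ler_wpM2l t0 uC.
  by apply/andP; split; lra.
pose Q : {poly R} := (delta0 / 2) *: ('X - a%:P) ^+ 2 + (derive1 phi a) *: 'X.
have QE x : Q.[x] = delta0 / 2 * (x - a) ^+ 2 + derive1 phi a * x.
  by rewrite !hornerE.
have dQE x : Q^`().[x] = delta0 * (x - a) + derive1 phi a.
  by rewrite /Q derivD !linearZ/= deriv_exp derivXsubC derivX !hornerE/=; field.
have [t t01|t t01] := @mean_value R (phi \- horner Q)
    (fun y => derive1 phi y - Q^`().[y]) a z.
  have [|y0 _] := seg t z t01 z0; first by rewrite cz.
  by apply: is_deriveB; exact: (@is_derive_phi 0%N).
set x := a + _ => /= Fz.
have [|x0 xc] := seg t z t01 z0; first by rewrite cz.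
have [s s01|s s01] := @mean_value R (derive1 phi) (derive1n 2 phi) a x.
  have [y0 _] := seg s x s01 x0 xc.
  exact: (@is_derive_phi 1%N).
have [y0 yc] := seg s x s01 x0 xc.
set y := a + _ in y0 yc * => dx.
have d2 := phi2_gt yc y0.
move: Fz; rewrite !QE dQE.
have -> : derive1 phi x - (delta0 * (x - a) + derive1 phi a) =
          (derive1n 2 phi y - delta0) * (x - a).
  by rewrite mulrBl -dx; ring.
have -> : (derive1n 2 phi y - delta0) * (x - a) * (z - a) =
          (derive1n 2 phi y - delta0) * t * (z - a) ^+ 2.
  by rewrite /x; ring.
have : 0 <= (derive1n 2 phi y - delta0) * t * (z - a) ^+ 2.
  rewrite mulr_ge0 ?sqr_ge0// mulr_ge0// ?subr_ge0 ?(ltW d2)//.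
  by case/andP: t01.
by move=> H1 H2; lra.
Qed.

(* At z = 0 phi need not be continuous, but convexity bounds it from below by
   its values on the segment from a to 0. *)
Let strong_convex (a z : R) : 0 < a -> 0 <= z -> c0 <= a <= C0 -> c0 <= z <= C0 ->
  phi a + derive1 phi a * (z - a) + delta0 / 2 * (z - a) ^+ 2 <= phi z.
Proof.
move=> a0; rewrite le_eqVlt => /orP[/eqP<-|z0] ca cz; last first.
  exact: strong_convex_gt0.
rewrite sub0r; apply/ler_addgt0Pr => e e0.
set b := delta0 / 2 * a ^+ 2.
have b0 : 0 < b by rewrite mulr_gt0 ?divr_gt0// exprn_gt0.
(* The strong convexity bound at [t * a] is combined with phi (t a) <= t phi a + (1 - t) phi 0.
   After division by 1 - t the loss is [t * b], at most e / 2; t <= 1 / 2 keeps 1 - t positive. *)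
pose t := Num.min (1 / 2) (e / (2 * b)).
have t0 : 0 < t by rewrite lt_min !divr_gt0// mulr_gt0.
have t12 : t <= 1 / 2 by rewrite ge_min lexx.
have tb : t * (2 * b) <= e by rewrite -ler_pdivlMr ?mulr_gt0// ge_min lexx orbT.
have tac : c0 <= t * a <= C0.
  case/andP: ca => ca aC; case/andP: cz => c00 _.
  rewrite (le_trans c00) ?mulr_ge0 ?(ltW t0) ?(ltW a0)//=.
  by rewrite (le_trans _ aC)// ler_piMl ?(ltW a0)//; lra.
have H := strong_convex_gt0 a0 (mulr_gt0 t0 a0) ca tac.
have t01 : 0 <= t <= 1 by rewrite (ltW t0); lra.
have := cvx (ltW a0) (lexx 0) t01; rewrite mulr0 addr0 => K.
have {H K} H : (1 - t) * (phi a - derive1 phi a * a + (1 - t) * b) <=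
    (1 - t) * phi 0.
  have E : phi a + derive1 phi a * (t * a - a) + delta0 / 2 * (t * a - a) ^+ 2 =
    phi a - (1 - t) * (derive1 phi a * a) + (1 - t) ^+ 2 * b.
    by rewrite /b; field.
  by rewrite E in H; lra.
have {}H : phi a - derive1 phi a * a + (1 - t) * b <= phi 0.
  by rewrite -(ler_pM2l (_ : 0 < 1 - t))//; lra.
by rewrite sqrrN -/b mulrN; lra.
Qed.

Lemma tame_divergenceP : exists eta C D, tame_divergence phi (derive1 phi) q
  (derive1n 2 phi 1) (derive1n 3 phi 1) (derive1n 4 phi 1)
  eta C (delta0 / 2) D.
Proof.
have q2 : 0 < q / 2 by rewrite divr_gt0.
have /cvgr0Pnorm_lt/(_ 1 ltr01) : derive1n 5 phi y - derive1n 5 phi 1 @[y --> (1 : R)] --> 0.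
  by apply/subr_cvg0; exact: c_phi5.
move=> /nbhs_ballP[e1 /= e1_gt0 phi5e].
have c_phi : {for 1, continuous phi}.
  apply/differentiable_continuous/derivable1_diffP.
  exact: (@d_phi 0%N).
have /cvgr0Pnorm_lt/(_ _ q2) : phi y - phi 1 @[y --> (1 : R)] --> 0.
  by apply/subr_cvg0; exact: c_phi.
move=> /nbhs_ballP[e2 /= e2_gt0 phie].
(* The three bounds keep 1 + y positive, the fifth derivative within 1 of its value at 1, and phi (1
   + y) below q / 2, that is, 1 + y inside [c0, C0]. *)
pose eta := Num.min (1 / 2) (Num.min (e1 / 2) (e2 / 2)).
have eta_gt0 : 0 < eta by rewrite !lt_min !divr_gt0.
have eta12 : eta <= 1 / 2 by rewrite ge_min lexx.
have eta1 : eta < e1.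
  by rewrite !gt_min (_ : e1 / 2 < e1) ?orbT// ltr_pdivrMr// ltr_pMr// ltr1n.
have eta2 : eta < e2.
  by rewrite !gt_min (_ : e2 / 2 < e2) ?orbT// ltr_pdivrMr// ltr_pMr// ltr1n.
pose M := `|derive1n 5 phi 1| + 1.
have M0 : 0 <= M by rewrite addr_ge0.
have gt0 (y : R) : `|y - 1| <= eta -> 0 < y by rewrite ler_norml; lra.
have bM (y : R) : `|y - 1| <= eta -> `|derive1n 5 phi y| <= M.
  move=> ye; have : `|derive1n 5 phi y - derive1n 5 phi 1| < 1.
    by apply: phi5e; rewrite -ball_normE /= distrC (le_lt_trans ye).
  move=> /ltW H; rewrite -(subrK (derive1n 5 phi 1) (derive1n 5 phi y)).
  by rewrite (le_trans (ler_normD _ _))// addrC lerD2l.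
have in_range (y : R) : `|y| <= eta -> c0 <= 1 + y <= C0.
  move=> ye; apply/rangeP; split; first by move: ye; rewrite ler_norml; lra.
  have : `|phi (1 + y) - phi 1| < q / 2.
    by apply: phie; rewrite -ball_normE /= opprD addrA subrr sub0r normrN (le_lt_trans ye).
  by rewrite phi1 subr0 => /ltW; apply: le_trans; exact: ler_norm.
have T0 (y : R) : `|y| <= eta ->
    `|phi (1 + y) - (derive1n 2 phi 1 / 2 * y ^+ 2 +
      derive1n 3 phi 1 / 6 * y ^+ 3 + derive1n 4 phi 1 / 24 * y ^+ 4)| <=
    M * `|y| ^+ 5.
  move=> ye; have := @taylor_remainder R 5 phi 1 eta M.
  move=> /(_ _ bM (1 + y)); rewrite addrAC subrr add0r => /(_ _ ye).
  have -> : \sum_(k < 5) derive1n k phi 1 / k`!%:R * y ^+ k =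
      derive1n 2 phi 1 / 2 * y ^+ 2 + derive1n 3 phi 1 / 6 * y ^+ 3 +
      derive1n 4 phi 1 / 24 * y ^+ 4.
    rewrite (@taylor_sum5 (fun k => derive1n k phi 1)) [derive1n 0 phi 1]phi1.
    by rewrite [derive1n 1 phi 1]dphi1 mul0r !add0r.
  by apply=> k k5 z /gt0; exact: d_phi.
have T1 (y : R) : `|y| <= eta ->
    `|derive1 phi (1 + y) - (derive1n 2 phi 1 * y +
      derive1n 3 phi 1 / 2 * y ^+ 2 + derive1n 4 phi 1 / 6 * y ^+ 3)| <=
    M * `|y| ^+ 4.
  move=> ye; have := @taylor_remainder R 4 (derive1 phi) 1 eta M.
  have dE k : derive1n k (derive1 phi) = derive1n k.+1 phi.
    by rewrite /derive1n iterSr.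
  rewrite dE => /(_ _ bM (1 + y)); rewrite addrAC subrr add0r => /(_ _ ye).
  have -> : \sum_(k < 4) derive1n k (derive1 phi) 1 / k`!%:R * y ^+ k =
      derive1n 2 phi 1 * y + derive1n 3 phi 1 / 2 * y ^+ 2 +
      derive1n 4 phi 1 / 6 * y ^+ 3.
    rewrite (@taylor_sum4 (fun k => derive1n k (derive1 phi) 1)) !dE.
    by rewrite [derive1n 1 phi 1]dphi1 add0r.
  by apply=> k k5 z /gt0; rewrite dE; exact: d_phi.
(* The summand |phi''''(1)| absorbs the cubic term of phi', which the second Taylor bound leaves in
   its remainder. *)
exists eta, (M + `|derive1n 4 phi 1|), (`|c0 - 1| + `|C0 - 1|); split.
- by rewrite eta_gt0/=; lra.
- by rewrite addr_ge0.
- by rewrite divr_gt0.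
- move=> y ye; apply: le_trans (T0 y ye) _.
  by rewrite ler_wpM2r ?exprn_ge0// lerDl.
- move=> y ye; set p := derive1n 2 phi 1; set p3 := derive1n 3 phi 1.
  set p4 := derive1n 4 phi 1.
  have -> : derive1 phi (1 + y) - (p * y + p3 / 2 * y ^+ 2) =
    (derive1 phi (1 + y) - (p * y + p3 / 2 * y ^+ 2 + p4 / 6 * y ^+ 3)) +
    p4 / 6 * y ^+ 3 by ring.
  apply: le_trans (ler_normD _ _) _; rewrite mulrDl; apply: lerD.
    apply: le_trans (T1 y ye) _; rewrite ler_wpM2l// exprSr.
    by rewrite ler_piMr ?exprn_ge0//; lra.
  rewrite normrM normrX normrM ler_wpM2r ?exprn_ge0// ler_piMr//.
  by rewrite ger0_norm// ?invr_ge0//; lra.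
- move=> y z ye z0 zq; apply: strong_convex => //.
  + by move: ye; rewrite ler_norml; lra.
  + exact: in_range.
  + exact/rangeP.
- move=> y t ye t01.
  have -> : 1 + t * y = t * (1 + y) + (1 - t) * 1 by ring.
  have y0 : 0 <= 1 + y by move: ye; rewrite ler_norml; lra.
  by have := cvx y0 ler01 t01; rewrite phi1 mulr0 addr0.
- move=> z z0 zq; have /rangeP/andP[cz zC] : 0 <= z /\ phi z <= q / 2 by [].
  rewrite ler_norml; have := ler_norm (C0 - 1); have := ler_norm (- (c0 - 1)).
  have := normr_ge0 (C0 - 1); have := normr_ge0 (c0 - 1).
  rewrite normrN; lra.
Qed.

End tame.

(** * Weak duality *)

Section duality.
Context (R : realType) (phi dphi : R -> R) (q p p3 p4 eta C dl D : R).
Hypothesis q_gt0 : 0 < q.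
Hypothesis tphi : tame_divergence phi dphi q p p3 p4 eta C dl D.

Lemma tame_phi1 : phi 1 = 0.
Proof.
have := tame_taylor tphi (y := 0); rewrite normr0 !expr0n/= !mulr0 !addr0 subr0.
by case/andP: (tame_eta tphi) => /ltW e0 _ /(_ e0); rewrite normr_le0 => /eqP.
Qed.

Lemma tame_dphi1 : dphi 1 = 0.
Proof.
have := tame_taylor' tphi (y := 0); rewrite normr0 !expr0n/= !mulr0 !addr0 subr0.
by case/andP: (tame_eta tphi) => /ltW e0 _ /(_ e0); rewrite normr_le0 => /eqP.
Qed.

Lemma tame_ge0 z : 0 <= z -> 0 <= phi z.
Proof.
move=> z0; have [zq|/ltW] := leP (phi z) (q / 2); last first.
  by apply: le_trans; rewrite ltW ?divr_gt0.
have e0 : `|0 : R| <= eta by rewrite normr0; case/andP: (tame_eta tphi) => /ltW.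
have := tame_convex tphi e0 z0 zq; rewrite addr0 tame_phi1 tame_dphi1 mul0r !add0r.
by apply: le_trans; rewrite mulr_ge0 ?sqr_ge0// ltW// (tame_dl tphi).
Qed.

Context (m : nat).
Implicit Types L : lratio R m.+1.

(** As phi is nonnegative, one value is at most n times the average. This puts every feasible L
    pointwise into the range where phi is strongly convex. *)
Lemma feasible_le L j : avg (fun i => phi (L i)) <= q / (2 * m.+1%:R) ->
  phi (L j) <= q / 2.
Proof.
move=> fL; have := @ler_term_avg R m (fun i => phi (L i)) j.
move=> /(_ (fun i => tame_ge0 (lr_ge0 L i))) /le_trans; apply.
rewrite -ler_pdivlMl ?ltr0n// (le_trans fL)//.
by rewrite invfM [_^-1 * (q / 2)]mulrC mulrA.
Qed.

Variables (f : 'I_m.+1 -> R) (F2 : 'I_m.+1 -> 'I_m.+1 -> R).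
Variable F3 : 'I_m.+1 -> 'I_m.+1 -> 'I_m.+1 -> R.
Hypothesis F2C : forall i j, F2 j i = F2 i j.
Hypothesis F3C12 : forall i j k, F3 j i k = F3 i j k.
Hypothesis F3C23 : forall i j k, F3 i k j = F3 i j k.

(** The Taylor expansion of a cubic polynomial at [y] is exact. The average against [h] contains the
    gradient; symmetry of the kernels merges the equal slots. *)
Lemma cubic_expansionD (y h : 'I_m.+1 -> R) :
  cubic_expansion f F2 F3 (fun j => y j + h j) = cubic_expansion f F2 F3 y +
  (avg (fun j => h j * (f j + op2 F2 y j + 1 / 2 * op3 F3 y y j)) +
   (1 / 2 * form2 F2 h h + 1 / 2 * form3 F3 y h h + 1 / 6 * form3 F3 h h h)).
Proof.
have -> : (fun j => y j + h j) = (fun j => 1 * y j + 1 * h j).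
  by apply/funext => j; rewrite !mul1r.
rewrite /cubic_expansion form2_diag_lin// form3_diag_lin//.
have -> : avg (fun j => h j * (f j + op2 F2 y j + 1 / 2 * op3 F3 y y j)) =
    avg (fun j => h j * f j) + form2 F2 y h + 1 / 2 * form3 F3 y y h.
  rewrite (form2C F2C) (form3C23 F3C23) (form3C12 F3C12) /form2 /form3 -avgZ.
  by rewrite -!avgD; apply: eq_avg => j; ring.
have -> : avg (fun j => (1 * y j + 1 * h j) * f j) =
    avg (fun j => y j * f j) + avg (fun j => h j * f j).
  by rewrite -avgD; apply: eq_avg => j; ring.
by field.
Qed.

Let le_of_sqr_le (x k K l : R) : x ^+ 2 <= k * l ^+ 2 -> k <= K ^+ 2 -> 0 <= K ->
  0 <= l -> x <= K * l.
Proof.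
move=> xk kK K0 l0; apply: le_trans (ler_norm x) _.
rewrite -(@ler_pXn2r _ 2)// ?nnegrE ?mulr_ge0// real_normK ?num_real// exprMn.
by rewrite (le_trans xk)// ler_wpM2r ?sqr_ge0.
Qed.

(* Weak duality for the Lagrangian
   cubic_expansion - alpha * (avg phi - q / (2 n)) - beta * (avg L - 1):
   it is strongly concave on the feasible range once alpha is large, so a point
   [1 + y] with small gradient [res] is nearly optimal. *)
Lemma weak_duality L (y : 'I_m.+1 -> R) (alpha beta A2 A3 : R)
  (res := fun j => f j + op2 F2 y j + 1 / 2 * op3 F3 y y j
                   - alpha * dphi (1 + y j) - beta) :
  (forall j, `|y j| <= eta) -> avg y = 0 -> 0 < alpha ->
  avg (fun i => avg (fun j => F2 i j ^+ 2)) <= A2 ->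
  avg (fun i => avg (fun j => avg (fun k => F3 i j k ^+ 2))) <= A3 ->
  1 + A2 + A3 + (D + 1) ^+ 2 <= alpha * dl / 2 ->
  avg (fun i => phi (L i)) <= q / (2 * m.+1%:R) ->
  cubic_expansion f F2 F3 (fun j => L j - 1) <=
  cubic_expansion f F2 F3 y + avg (fun j => res j ^+ 2) / (2 * alpha * dl)
  + alpha * (q / (2 * m.+1%:R) - avg (fun j => phi (1 + y j))).
Proof.
move=> ye y0 alpha0 FA2 FA3 Aalpha fL.
have dl0 := tame_dl tphi.
pose h j := L j - (1 + y j).
have hE : (fun j => L j - 1) = (fun j => y j + h j).
  by apply/funext => j; rewrite /h; ring.
have h0 : avg h = 0.
  have := lr_avg L; rewrite -[X in X = 1](_ : avg (fun j => 1 + (y j + h j)) = _).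
    by rewrite !avgD avg_cst y0; lra.
  by apply: eq_avg => j; rewrite /h; ring.
set lam := avg (fun j => h j ^+ 2).
have lam0 : 0 <= lam by apply: avg_ge0 => j; exact: sqr_ge0.
have hD j : `|h j| <= D + 1.
  have Lj := tame_range tphi (lr_ge0 L j) (feasible_le j fL).
  have -> : h j = (L j - 1) - y j by rewrite /h; ring.
  apply: le_trans (ler_normB _ _) _; rewrite lerD// (le_trans (ye j))// ltW//.
  by case/andP: (tame_eta tphi).
have lamD : lam <= (D + 1) ^+ 2.
  rewrite -(@avg_cst _ m ((D + 1) ^+ 2)); apply: ler_avg => j.
  by rewrite -real_normK ?num_real// lerXn2r ?nnegrE// (le_trans _ (hD j)).
have y2 : avg (fun j => y j ^+ 2) <= 1.
  rewrite -(@avg_cst _ m 1); apply: ler_avg => j.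
  rewrite -real_normK ?num_real// -(expr1n _ 2) lerXn2r ?nnegrE//.
  by rewrite (le_trans (ye j))// ltW//; case/andP: (tame_eta tphi).
have A20 : 0 <= A2.
  by apply: le_trans FA2; do 2!apply: avg_ge0 => ?; exact: sqr_ge0.
have A30 : 0 <= A3.
  by apply: le_trans FA3; do 3!apply: avg_ge0 => ?; exact: sqr_ge0.
have D20 : 0 <= (D + 1) ^+ 2 by exact: sqr_ge0.
(* Cauchy-Schwarz gives the constant sqrt A2; the larger 1 + A2 avoids square roots in the condition
   on [alpha]. *)
have B2 : form2 F2 h h <= (1 + A2) * lam.
  apply: (@le_of_sqr_le _ A2) => //; [|by nra|by lra].
  apply: le_trans (form2_sqr_le _ _ _) _.
  by rewrite -/lam -expr2 ler_wpM2r ?sqr_ge0.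
have B3 : form3 F3 y h h <= (1 + A3) * lam.
  apply: (@le_of_sqr_le _ A3) => //; [|by nra|by lra].
  apply: le_trans (form3_sqr_le _ _ _ _) _.
  rewrite -/lam -expr2; apply: ler_pM => //.
  - by do 3!apply: avg_ge0 => ?; exact: sqr_ge0.
  - by rewrite mulr_ge0 ?sqr_ge0//; apply: avg_ge0 => ?; exact: sqr_ge0.
  - by rewrite ler_piMl ?sqr_ge0.
(* Feasible points need not be close to 1, so the cubic form is made comparable with [lam] by the a
   priori bound lam <= (D + 1)^2 and sqrt (a b) <= a + b. *)
have B3h : form3 F3 h h h <= (A3 + (D + 1) ^+ 2) * lam.
  apply: (@le_of_sqr_le _ (A3 * (D + 1) ^+ 2)) => //; [|by nra|by lra].
  apply: le_trans (form3_sqr_le _ _ _ _) _.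
  rewrite -/lam -expr2 -mulrA; apply: ler_pM => //.
  - by do 3!apply: avg_ge0 => ?; exact: sqr_ge0.
  - by rewrite mulr_ge0 ?sqr_ge0//.
  - by rewrite ler_wpM2r ?sqr_ge0.
have conv : avg (fun j => phi (1 + y j)) + avg (fun j => dphi (1 + y j) * h j) +
    dl * lam <= q / (2 * m.+1%:R).
  rewrite (le_trans _ fL)// -avgZ -!avgD; apply: ler_avg => j.
  have Hc := tame_convex tphi (ye j) (lr_ge0 L j) (feasible_le j fL).
  exact: Hc.
(* Half of the concavity gain [alpha * dl * lam] absorbs the linear residual here; the other half is
   what [Aalpha] sets against the forms in [h]. *)
have young : avg (fun j => res j * h j) <=
    alpha * dl / 2 * lam + avg (fun j => res j ^+ 2) / (2 * alpha * dl).
  rewrite [X in _ + X]mulrC -!avgZ -avgD; apply: ler_avg => j.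
  have ad0 : 0 < alpha * dl by rewrite mulr_gt0.
  rewrite -subr_ge0.
  have -> : alpha * dl / 2 * h j ^+ 2 + (2 * alpha * dl)^-1 * res j ^+ 2 -
      res j * h j = (alpha * dl * h j - res j) ^+ 2 / (2 * (alpha * dl)).
    by field; rewrite !gt_eqF.
  by rewrite divr_ge0 ?sqr_ge0// mulr_ge0// ltW.
rewrite hE cubic_expansionD -!addrA lerD2l.
(* The multiplier [beta] disappears because [h] has average zero. *)
have -> : avg (fun j => h j * (f j + op2 F2 y j + 1 / 2 * op3 F3 y y j)) =
    avg (fun j => res j * h j) + alpha * avg (fun j => dphi (1 + y j) * h j).
  rewrite -[RHS]addr0 -(mulr0 beta) -h0 -!avgZ -!avgD.
  by apply: eq_avg => j; rewrite /res; ring.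
have := ler_wpM2l (ltW alpha0) conv; have := ler_wpM2r lam0 Aalpha.
have : 0 <= (1 / 3 * A3 + 5 / 6 * (D + 1) ^+ 2 + 1 / 2 * A2) * lam.
  by rewrite mulr_ge0//; lra.
move: B2 B3 B3h young; clear.
move: (avg _ / (2 * alpha * dl)) (avg (fun j => res j * h j)) => V W.
move: (avg (fun j => phi _)) (avg (fun j => _ * h j)) (q / _) => X Y Z.
move: (form2 F2 h h) (form3 F3 y h h) (form3 F3 h h h) ((D + 1) ^+ 2) => a b c d.
by lra.
Qed.

End duality.

(** * The nearly optimal point *)

Section perturbation.
Context (R : realType).
Implicit Types (s t d z K a : R).

Let pow24_le t : 0 <= t -> t ^+ 2 <= 1 + t ^+ 5 /\ t ^+ 4 <= 1 + t ^+ 5.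
Proof.
move=> t0; have [t1|/ltW t1] := leP t 1.
  have t5 : 0 <= t ^+ 5 by exact: exprn_ge0.
  by split; rewrite (@le_trans _ _ 1) ?lerDl// exprn_ile1.
by split; rewrite (@le_trans _ _ (t ^+ 5)) ?lerDr ?ler_weXn2l.
Qed.

Lemma sqr_le_pow5 a : a ^+ 2 <= 1 + `|a| ^+ 5.
Proof. by rewrite -real_normK ?num_real//; case: (pow24_le (normr_ge0 a)). Qed.

Lemma pow4_le_pow5 a : a ^+ 4 <= 1 + `|a| ^+ 5.
Proof.
have -> : a ^+ 4 = `|a| ^+ 4 by rewrite -normrX ger0_norm// exprn_even_ge0.
by case: (pow24_le (normr_ge0 a)).
Qed.

(** [s] and [t] stand for |b| and |f|. With only the fourth moment of b and the fifth of f at hand,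
    Young-type inequalities squeeze each monomial, such as s^2 t and s t^3, into W. *)
Let poly_bounds s t (W := 1 + t ^+ 5 + s ^+ 4) : 0 <= s -> 0 <= t ->
  [/\ (1 + t) ^+ 5 <= 32 * W, (s + t ^+ 2) ^+ 2 * (1 + t) <= 8 * W &
      (s + t ^+ 2) * (1 + t) ^+ 3 <= 12 * W].
Proof.
move=> s0 t0; have [t2 t4] := pow24_le t0.
have s4 : 0 <= s ^+ 4 by exact: exprn_ge0.
have t5 : 0 <= t ^+ 5 by exact: exprn_ge0.
have s1 : s <= 1 + s ^+ 4.
  have [?|/ltW s1] := leP s 1; first by lra.
  by rewrite (@le_trans _ _ (s ^+ 4)) ?lerDr// ler_eXnr.
have s2 : 2 * s ^+ 2 <= 1 + s ^+ 4.
  by have := sqr_ge0 (s ^+ 2 - 1); rewrite sqrrB -exprM; lra.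
have s2t : 2 * (s ^+ 2 * t) <= s ^+ 4 + t ^+ 2.
  by have := sqr_ge0 (s ^+ 2 - t); rewrite sqrrB -exprM; lra.
have st3 : s * t ^+ 3 <= s ^+ 4 + t ^+ 4.
  have [st|/ltW ts] := leP s t.
    rewrite (@le_trans _ _ (t ^+ 4)) ?lerDr//.
    by rewrite (exprS _ 3) ler_wpM2r ?exprn_ge0.
  rewrite (@le_trans _ _ (s ^+ 4)) ?lerDl ?exprn_ge0//.
  by rewrite (exprS _ 3) ler_wpM2l// lerXn2r.
have t35 : (1 + t) ^+ 3 <= 4 * (1 + t ^+ 3).
  rewrite -subr_ge0 (_ : _ - _ = 3 * (1 + t) * (1 - t) ^+ 2); last by ring.
  by rewrite mulr_ge0 ?sqr_ge0// mulr_ge0// addr_ge0.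
split; rewrite /W.
- have H : (1 + t) ^+ 5 <= 32 * (1 + t ^+ 5).
    have [t1|/ltW t1] := leP t 1.
      rewrite (@le_trans _ _ (2 ^+ 5))//; last by lra.
      by rewrite lerXn2r ?nnegrE ?addr_ge0//; lra.
    rewrite (@le_trans _ _ ((2 * t) ^+ 5))//; last by rewrite exprMn; lra.
    by rewrite lerXn2r ?nnegrE ?addr_ge0 ?mulr_ge0//; lra.
  by apply: le_trans H _; lra.
- have H : (s + t ^+ 2) ^+ 2 <= 2 * s ^+ 2 + 2 * t ^+ 4.
    by have := sqr_ge0 (s - t ^+ 2); rewrite sqrrB sqrrD -exprM; lra.
  have t10 : 0 <= 1 + t by lra.
  apply: le_trans (ler_wpM2r t10 H) _.
  rewrite [leLHS](_ : _ = 2 * s ^+ 2 + 2 * (s ^+ 2 * t) + 2 * t ^+ 4 + 2 * t ^+ 5).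
    by lra.
  by ring.
- have st0 : 0 <= s + t ^+ 2 by rewrite addr_ge0// exprn_ge0.
  apply: le_trans (ler_wpM2l st0 t35) _.
  rewrite [leLHS](_ : _ = 4 * (s + s * t ^+ 3 + t ^+ 2 + t ^+ 5)); first by lra.
  by ring.
Qed.

(** [e] is the first-order and [z] the second-order part of the candidate. Excess powers are traded
    for [d] through d^2 (|b| + f^2) <= d (1 + |f|), so that all four remainders are d^5 times a
    quantity with bounded average. *)
Lemma perturbation_bounds (d f b z K : R) (e := d * f)
    (W := 1 + `|f| ^+ 5 + b ^+ 4) (c := 1024 * K ^+ 5) :
  0 <= d <= 1 -> 1 <= K -> d * `|f| <= 1 -> d * `|b| <= 1 ->
  `|z| <= K * d ^+ 2 * (`|b| + f ^+ 2) ->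
  [/\ `|e + z| ^+ 5 <= c * d ^+ 5 * W,
      `|(e + z) ^+ 3 - (e ^+ 3 + 3 * e ^+ 2 * z)| <= c * d ^+ 5 * W,
      `|(e + z) ^+ 4 - e ^+ 4| <= c * d ^+ 5 * W &
      ((e + z) ^+ 2 - e ^+ 2) ^+ 2 <= c * d ^+ 5 * W].
Proof.
move=> /andP[d0 d1] K1 df1 db1 zK; have K0 := le_trans ler01 K1.
set t := `|f| in df1 *; set s := `|b| in db1 zK *.
have t0 : 0 <= t by exact: normr_ge0.
have s0 : 0 <= s by exact: normr_ge0.
have t2E : f ^+ 2 = t ^+ 2 by rewrite real_normK// num_real.
have WE : W = 1 + t ^+ 5 + s ^+ 4.
  by rewrite /W -/t -(@ger0_norm _ (b ^+ 4)) ?exprn_even_ge0// normrX.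
have W0 : 0 <= W by rewrite WE !addr_ge0// exprn_ge0.
have [P5 P2 P3] := poly_bounds s0 t0; rewrite -WE in P5 P2 P3.
rewrite t2E in zK; set Z := `|z| in zK.
have Z0 : 0 <= Z by exact: normr_ge0.
have eE : `|e| = d * t by rewrite /e normrM (ger0_norm d0).
have ds : d ^+ 2 * (s + t ^+ 2) <= d * (1 + t).
  rewrite expr2 -mulrA ler_wpM2l// mulrDr lerD//.
  by rewrite expr2 mulrA ler_piMl.
have Z1 : Z <= K * (d * (1 + t)).
  by apply: le_trans zK _; rewrite -mulrA ler_wpM2l.
have dt1 : 0 <= d * (1 + t) by rewrite mulr_ge0// addr_ge0.
have dt2 : d * (1 + t) <= 2 by lra.
have S1 : `|e| + Z <= 2 * K * (d * (1 + t)).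
  have : d * t <= K * (d * (1 + t)).
    rewrite (@le_trans _ _ (d * (1 + t)))//; first by rewrite ler_wpM2l//; lra.
    by rewrite ler_peMl.
  by rewrite eE; lra.
set S := `|e| + Z in S1.
have S0 : 0 <= S by rewrite addr_ge0.
have eS : `|e| <= S by rewrite lerDl.
have Kn n : (n <= 5)%N -> K ^+ n <= K ^+ 5 by move=> ?; exact: ler_weXn2l.
have d5 : 0 <= d ^+ 5 by exact: exprn_ge0.
(* 1024 = 32 * 32 comes from the fifth power, the largest of the four cases; the others need 6 * 8,
   32 * 12 and 32 * 8. *)
have fin a n X k : (n <= 5)%N -> X <= k * W -> 0 <= a -> 0 <= k -> a * k <= 1024 ->
    a * K ^+ n * d ^+ 5 * X <= 1024 * K ^+ 5 * d ^+ 5 * W.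
  move=> n5 Xk a0 k0 ak.
  have A0 : 0 <= a * K ^+ n * d ^+ 5 by rewrite !mulr_ge0// exprn_ge0.
  apply: le_trans (ler_wpM2l A0 Xk) _.
  rewrite mulrA ler_wpM2r// [_ * k]mulrAC ler_wpM2r// [_ * k]mulrAC.
  by apply: ler_pM; rewrite ?exprn_ge0 ?Kn ?mulr_ge0.
have Z2 : Z ^+ 2 <= K ^+ 2 * d ^+ 4 * (s + t ^+ 2) ^+ 2.
  rewrite [leRHS](_ : _ = (K * d ^+ 2 * (s + t ^+ 2)) ^+ 2); last by ring.
  by rewrite lerXn2r ?nnegrE// (le_trans Z0).
split.
- have H : `|e + z| ^+ 5 <= (2 * K * (d * (1 + t))) ^+ 5.
    rewrite lerXn2r ?nnegrE// ?(le_trans _ S1)//.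
    exact: ler_normD.
  apply: le_trans H _.
  rewrite [leLHS](_ : _ = 32 * K ^+ 5 * d ^+ 5 * (1 + t) ^+ 5); last by ring.
  by apply: (fin _ _ _ 32) => //; lra.
- have -> : (e + z) ^+ 3 - (e ^+ 3 + 3 * e ^+ 2 * z) = z ^+ 2 * (3 * e + z).
    by ring.
  have H : `|z ^+ 2 * (3 * e + z)| <= Z ^+ 2 * (3 * S).
    rewrite normrM normrX ler_wpM2l ?exprn_ge0//.
    rewrite (le_trans (ler_normD _ _))// normrM ger0_norm// mulrDr lerD2l.
    by rewrite ler_peMl//; lra.
  apply: le_trans H _.
  have H : Z ^+ 2 * (3 * S) <= K ^+ 2 * d ^+ 4 * (s + t ^+ 2) ^+ 2 *
      (3 * (2 * K * (d * (1 + t)))).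
    by apply: ler_pM; rewrite ?exprn_ge0 ?mulr_ge0//; lra.
  apply: le_trans H _.
  rewrite [leLHS](_ : _ = 6 * K ^+ 3 * d ^+ 5 * ((s + t ^+ 2) ^+ 2 * (1 + t))).
    by apply: (fin _ _ _ 8) => //; lra.
  by ring.
- have -> : (e + z) ^+ 4 - e ^+ 4 = z * (((e + z) + e) * ((e + z) ^+ 2 + e ^+ 2)).
    by ring.
  have ezS : `|e + z| <= S by exact: ler_normD.
  have H : `|z * (((e + z) + e) * ((e + z) ^+ 2 + e ^+ 2))| <= Z * (4 * S ^+ 3).
    rewrite normrM ler_wpM2l// normrM.
    rewrite (_ : 4 * S ^+ 3 = (S + S) * (S ^+ 2 + S ^+ 2)); last by ring.
    apply: ler_pM => //.
      by rewrite (le_trans (ler_normD _ _))// lerD.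
    rewrite (le_trans (ler_normD _ _))// !normrX.
    by apply: lerD; rewrite lerXn2r ?nnegrE.
  apply: le_trans H _.
  have H : Z * (4 * S ^+ 3) <= K * d ^+ 2 * (s + t ^+ 2) *
      (4 * (2 * K * (d * (1 + t))) ^+ 3).
    apply: ler_pM => //; first by rewrite mulr_ge0// exprn_ge0.
    rewrite ler_wpM2l// lerXn2r ?nnegrE//.
    by rewrite (le_trans S0).
  apply: le_trans H _.
  rewrite [leLHS](_ : _ = 32 * K ^+ 4 * d ^+ 5 * ((s + t ^+ 2) * (1 + t) ^+ 3)).
    by apply: (fin _ _ _ 12) => //; lra.
  by ring.
- have ezS : `|(e + z) + e| <= 2 * S.
    rewrite (le_trans (ler_normD _ _))// mulr_natl mulr2n lerD//.
    exact: ler_normD.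
  have -> : ((e + z) ^+ 2 - e ^+ 2) ^+ 2 = `|z| ^+ 2 * `|(e + z) + e| ^+ 2.
    by rewrite !real_normK ?num_real//; ring.
  have H : `|z| ^+ 2 * `|(e + z) + e| ^+ 2 <= Z ^+ 2 * (2 * S) ^+ 2.
    by rewrite ler_wpM2l ?sqr_ge0// lerXn2r ?nnegrE// mulr_ge0.
  apply: le_trans H _.
  have S2 : (2 * S) ^+ 2 <= 16 * K * (2 * K * (d * (1 + t))).
    rewrite [leLHS](_ : _ = 2 * 2 * S * S); last by ring.
    apply: (@le_trans _ _ (2 * 2 * S * (2 * K * (d * (1 + t))))).
      by rewrite ler_wpM2l// !mulr_ge0.
    apply: ler_wpM2r; first by rewrite mulr_ge0// mulr_ge0.
    rewrite (le_trans (ler_wpM2l _ S1))// [leLHS](_ : _ = 8 * K * (d * (1 + t))); last by ring.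
    by rewrite (le_trans (ler_wpM2l _ dt2)) ?mulr_ge0//; lra.
  have H : Z ^+ 2 * (2 * S) ^+ 2 <= K ^+ 2 * d ^+ 4 * (s + t ^+ 2) ^+ 2 *
      (16 * K * (2 * K * (d * (1 + t)))).
    by apply: ler_pM; rewrite ?exprn_ge0 ?mulr_ge0.
  apply: le_trans H _.
  rewrite [leLHS](_ : _ = 32 * K ^+ 4 * d ^+ 5 * ((s + t ^+ 2) ^+ 2 * (1 + t))).
    by apply: (fin _ _ _ 8) => //; lra.
  by ring.
Qed.

End perturbation.

(** * Value, divergence and gradient at the candidate *)

Section candidate.
Context (R : realType) (phi dphi : R -> R) (q p p3 p4 eta C dl D : R).
Hypothesis p_gt0 : 0 < p.
Hypothesis tphi : tame_divergence phi dphi q p p3 p4 eta C dl D.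
Context (m : nat) (f : 'I_m.+1 -> R) (F2 : 'I_m.+1 -> 'I_m.+1 -> R).
Variable F3 : 'I_m.+1 -> 'I_m.+1 -> 'I_m.+1 -> R.
Hypothesis F2C : forall i j, F2 j i = F2 i j.
Hypothesis F3C12 : forall i j k, F3 j i k = F3 i j k.
Hypothesis F3C23 : forall i j k, F3 i k j = F3 i j k.
Hypothesis avg_f : avg f = 0.
Hypothesis avg_F2 : forall j, avg (fun i => F2 i j) = 0.
Variables (kap delta : R).
Hypothesis kapE : avg (fun j => f j ^+ 2) = kap.

Let rho := p3 / p.
Let g := op2 F2 f.
Let gam := avg (fun j => f j ^+ 3).
Let m4 := avg (fun j => f j ^+ 4).
Let m2a := avg (fun j => g j ^+ 2).
Let m2b := avg (fun j => f j ^+ 2 * g j).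
Let m2c := avg (fun j => f j * g j).
Let m3c := form3 F3 f f f.

(* Stationary point of the Lagrangian with multiplier [1 / (p delta)], up to
   relative order [delta ^ 2]. *)
Definition second_order j := op2 F2 f j - p3 / p / 2 * (f j ^+ 2 - kap).
Definition candidate j := delta * f j + delta ^+ 2 * second_order j.

Let w := second_order.
Let y := candidate.

Let avg_g : avg g = 0.
Proof.
rewrite /g /op2 exchange_avg -(@avg_cst R m 0); apply: eq_avg => j.
by rewrite avgZ avg_F2 mulr0.
Qed.

Lemma avg_candidate : avg y = 0.
Proof.
have -> : avg y = delta * avg f + delta ^+ 2 * (avg g + - (rho / 2) * avg (fun j =>
    f j ^+ 2 - kap)).
  by rewrite -!avgZ -!avgD -avgZ -avgD; apply: eq_avg => j; rewrite /y /candidate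
    /second_order -/g -/rho; ring.
by rewrite avg_f avg_g avgD avg_cst kapE subrr; ring.
Qed.

Let avg_fw : avg (fun j => f j * w j) = m2c - rho / 2 * gam.
Proof.
transitivity (m2c + (- (rho / 2)) * gam + rho / 2 * kap * avg f).
  rewrite /m2c /gam -!avgZ -!avgD; apply: eq_avg => j.
  by rewrite /w /second_order -/g -/rho; ring.
by rewrite avg_f; ring.
Qed.

Let avg_f2w : avg (fun j => f j ^+ 2 * w j) = m2b - rho / 2 * (m4 - kap ^+ 2).
Proof.
transitivity (m2b + (- (rho / 2)) * m4 + rho / 2 * kap * kap); last by ring.
rewrite /m2b /m4 -{2}kapE -!avgZ -!avgD; apply: eq_avg => j.
by rewrite /w /second_order -/g -/rho; ring.
Qed.

Let avg_gw : avg (fun j => g j * w j) = m2a - rho / 2 * m2b.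
Proof.
transitivity (m2a + (- (rho / 2)) * m2b + rho / 2 * kap * avg g).
  rewrite /m2a /m2b -!avgZ -!avgD; apply: eq_avg => j.
  by rewrite /w /second_order -/g -/rho; ring.
by rewrite avg_g; ring.
Qed.

Let avg_w2 : avg (fun j => w j ^+ 2) =
  m2a - rho * m2b + rho ^+ 2 / 4 * (m4 - kap ^+ 2).
Proof.
transitivity (m2a + (- rho) * m2b + rho * kap * avg g +
  rho ^+ 2 / 4 * (m4 + (- 2 * kap) * kap + kap ^+ 2)).
  rewrite -(@avg_cst R m (kap ^+ 2)) /m2a /m2b /m4 -{3}kapE.
  rewrite -!avgZ -!avgD -avgZ -!avgD; apply: eq_avg => j.
  by rewrite /w /second_order -/g -/rho; field.
by rewrite avg_g; field.
Qed.

(** The cross term form2 f w equals the average of g w, so all coefficients up to delta^3 are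
    moments. The fourth derivative of phi does not occur: it enters the final expansion through the
    constraint, which fixes delta. *)
Lemma candidate_value : cubic_expansion f F2 F3 y =
  delta * kap + delta ^+ 2 * (3 / 2 * m2c - rho / 2 * gam) +
  delta ^+ 3 * (m2a - rho / 2 * m2b + 1 / 6 * m3c) +
  delta ^+ 4 * (1 / 2 * form2 F2 w w + 1 / 2 * form3 F3 f f w +
    1 / 2 * delta * form3 F3 f w w + 1 / 6 * delta ^+ 2 * form3 F3 w w w).
Proof.
rewrite /cubic_expansion /y /candidate form2_diag_lin// form3_diag_lin//.
have -> : avg (fun j => (delta * f j + delta ^+ 2 * second_order j) * f j) =
    delta * kap + delta ^+ 2 * (m2c - rho / 2 * gam).
  by rewrite -avg_fw -{1}kapE -!avgZ -!avgD; apply: eq_avg => j; rewrite /w; ring.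
have -> : form2 F2 f second_order = m2a - rho / 2 * m2b.
  by rewrite form2C// -avg_gw; apply: eq_avg => j; rewrite mulrC.
have -> : form2 F2 f f = m2c by [].
have -> : form3 F3 f f f = m3c by [].
by rewrite -/w; field.
Qed.

(** Chosen so that w = b - rho / 2 f^2, the shape that [perturbation_bounds] asks for. *)
Let b j := g j + rho / 2 * kap.
Let W j := 1 + `|f j| ^+ 5 + b j ^+ 4.
Let K := 1 + `|rho|.

Hypothesis delta01 : 0 < delta <= 1.
Hypothesis df1 : forall j, delta * `|f j| <= 1.
Hypothesis db1 : forall j, delta * `|b j| <= 1.
Hypothesis y_eta : forall j, `|y j| <= eta.

Let c := 1024 * K ^+ 5.

Let pb j : [/\ `|y j| ^+ 5 <= c * delta ^+ 5 * W j,
  `|y j ^+ 3 - ((delta * f j) ^+ 3 + 3 * (delta * f j) ^+ 2 * (delta ^+ 2 * w j))|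
    <= c * delta ^+ 5 * W j,
  `|y j ^+ 4 - (delta * f j) ^+ 4| <= c * delta ^+ 5 * W j &
  (y j ^+ 2 - (delta * f j) ^+ 2) ^+ 2 <= c * delta ^+ 5 * W j].
Proof.
case/andP: delta01 => d0 d1; apply: perturbation_bounds => //.
- by rewrite (ltW d0).
- by rewrite lerDl.
rewrite normrM ger0_norm ?sqr_ge0//.
rewrite [leRHS](_ : _ = delta ^+ 2 * (K * (`|b j| + f j ^+ 2))); last by ring.
rewrite ler_wpM2l ?sqr_ge0//.
have -> : second_order j = b j - rho / 2 * f j ^+ 2
  by rewrite /second_order -/g -/rho /b; ring.
apply: le_trans (ler_normB _ _) _.
rewrite normrM (@ger0_norm _ (f j ^+ 2)) ?sqr_ge0// normrM (@ger0_norm _ 2^-1)//.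
have := normr_ge0 (b j); have := sqr_ge0 (f j); have := normr_ge0 rho.
rewrite /K; move: (`|b j|) (f j ^+ 2) (`|rho|) => u v r r0 v0 u0.
by have := mulr_ge0 r0 u0; have := mulr_ge0 r0 v0; lra.
Qed.

Lemma candidate_divergence :
  `|avg (fun j => phi (1 + y j)) -
    (p / 2 * kap * delta ^+ 2 + (p * m2c - p3 / 3 * gam) * delta ^+ 3 +
     (p / 2 * m2a - p3 ^+ 2 / (8 * p) * (m4 - kap ^+ 2) + p4 / 24 * m4) *
     delta ^+ 4)| <=
  (C + `|p3| + `|p4|) * c * delta ^+ 5 * avg W.
Proof.
(* The square of [y] is kept exactly, its cube to first order in [w] and its fourth power to order
   zero: precisely the contributions up to delta^4, whose averages are moments already computed. *)
have -> : p / 2 * kap * delta ^+ 2 + (p * m2c - p3 / 3 * gam) * delta ^+ 3 +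
     (p / 2 * m2a - p3 ^+ 2 / (8 * p) * (m4 - kap ^+ 2) + p4 / 24 * m4) *
     delta ^+ 4 = avg (fun j => p / 2 * y j ^+ 2 + p3 / 6 * ((delta * f j) ^+ 3 +
       3 * (delta * f j) ^+ 2 * (delta ^+ 2 * w j)) + p4 / 24 * (delta * f j) ^+ 4).
  transitivity (p / 2 * delta ^+ 2 * kap +
    p * delta ^+ 3 * avg (fun j => f j * w j) +
    p / 2 * delta ^+ 4 * avg (fun j => w j ^+ 2) + p3 / 6 * delta ^+ 3 * gam +
    p3 / 2 * delta ^+ 4 * avg (fun j => f j ^+ 2 * w j) +
    p4 / 24 * delta ^+ 4 * m4).
    by rewrite avg_fw avg_w2 avg_f2w /rho; field; rewrite gt_eqF.
  rewrite -kapE /gam /m4 -!avgZ -!avgD; apply: eq_avg => j.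
  by rewrite /y /candidate -/w; field.
rewrite -avgB; apply: le_trans (ler_norm_avg _) _.
rewrite -avgZ; apply: ler_avg => j.
have [b5 b3 b4 _] := pb j; have T := tame_taylor tphi (y_eta j).
have C0 := tame_C tphi.
rewrite (_ : _ - _ = (phi (1 + y j) - (p / 2 * y j ^+ 2 + p3 / 6 * y j ^+ 3 +
    p4 / 24 * y j ^+ 4)) + (p3 / 6 * (y j ^+ 3 - ((delta * f j) ^+ 3 +
       3 * (delta * f j) ^+ 2 * (delta ^+ 2 * w j))) +
    p4 / 24 * (y j ^+ 4 - (delta * f j) ^+ 4))); last by ring.
have W0 : 0 <= c * delta ^+ 5 * W j by rewrite (le_trans _ b5)// exprn_ge0.
rewrite [leRHS](_ : _ = C * (c * delta ^+ 5 * W j) + (`|p3| * (c * delta ^+ 5 * W j) +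
    `|p4| * (c * delta ^+ 5 * W j))); last by ring.
apply: le_trans (ler_normD _ _) _; apply: lerD.
  by apply: le_trans T _; rewrite ler_wpM2l.
apply: le_trans (ler_normD _ _) _.
have le1 (a : R) k : `|a / k.+1%:R| <= `|a|.
  by rewrite normrM ler_piMr// ger0_norm ?invr_ge0// invf_le1// ler1n.
by apply: lerD; rewrite normrM; apply: ler_pM => //; exact: le1.
Qed.

(** With these multipliers f, g and the f^2 term cancel; [beta] is forced by centring [second_order]
    with [kap]. What remains are two kernel terms of order delta^2, the error of replacing y by
    delta f in the quadratic term of phi', and the Taylor remainder of phi'. The last two carry a
    factor 1 / delta, hence only delta^3 in mean square. *)
Lemma candidate_gradient (A2 A3 : R)
  (alpha := (p * delta)^-1) (beta := - (rho / 2 * kap * delta))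
  (res := fun j => f j + op2 F2 y j + 1 / 2 * op3 F3 y y j
                   - alpha * dphi (1 + y j) - beta) :
  avg (fun i => avg (fun j => F2 i j ^+ 2)) <= A2 ->
  avg (fun i => avg (fun j => avg (fun k => F3 i j k ^+ 2))) <= A3 ->
  avg (fun j => res j ^+ 2) <=
  4 * delta ^+ 4 * (A2 * avg (fun j => w j ^+ 2)) +
  A3 * avg (fun j => y j ^+ 2) ^+ 2 +
  (rho ^+ 2 + 4 * C ^+ 2 / p ^+ 2) * c * delta ^+ 3 * avg W.
Proof.
move=> FA2 FA3; case/andP: delta01 => d0 d1; have C0 := tame_C tphi.
have dN0 : delta != 0 by rewrite gt_eqF.
have pN0 : p != 0 by rewrite gt_eqF.
pose om j := dphi (1 + y j) - (p * y j + p3 / 2 * y j ^+ 2).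
have resE j : res j = delta ^+ 2 * op2 F2 w j + 1 / 2 * op3 F3 y y j -
    rho / (2 * delta) * (y j ^+ 2 - (delta * f j) ^+ 2) - alpha * om j.
  rewrite /res (_ : op2 F2 y j = delta * g j + delta ^+ 2 * op2 F2 w j); last first.
    exact: op2_lin.
  rewrite /om /alpha /beta.
  have -> : g j = w j + rho / 2 * (f j ^+ 2 - kap).
    by rewrite /w /second_order -/g -/rho; ring.
  have -> : f j = (y j - delta ^+ 2 * w j) / delta.
    by rewrite /y /candidate -/w; field.
  by rewrite /rho; field; rewrite dN0 pN0.
(* The square of the cubic remainder is a sixth power of |y|, lowered to the fifth by |y| <= 1 since
   [W] controls no more. *)
have om2 j : om j ^+ 2 <= C ^+ 2 * (c * delta ^+ 5 * W j).
  have y1 : `|y j| <= 1.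
    by rewrite (le_trans (y_eta j))// ltW//; case/andP: (tame_eta tphi).
  have [b5 _ _ _] := pb j.
  rewrite -real_normK ?num_real//.
  apply: (@le_trans _ _ ((C * `|y j| ^+ 3) ^+ 2)).
    rewrite lerXn2r ?nnegrE// ?mulr_ge0 ?exprn_ge0//.
    exact: (tame_taylor' tphi (y_eta j)).
  rewrite exprMn ler_wpM2l ?sqr_ge0// -exprM (le_trans _ b5)//.
  by rewrite (exprS _ 5) ler_piMl// exprn_ge0.
have sq4 (s t u v : R) : (s + t - u - v) ^+ 2 <=
    4 * (s ^+ 2 + t ^+ 2 + u ^+ 2 + v ^+ 2).
  rewrite -subr_ge0 (_ : _ - _ = (s - t) ^+ 2 + (s + u) ^+ 2 + (s + v) ^+ 2 +
    (t + u) ^+ 2 + (t + v) ^+ 2 + (u - v) ^+ 2); last by ring.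
  by rewrite !addr_ge0// sqr_ge0.
apply: (@le_trans _ _ (avg (fun j => 4 * delta ^+ 4 * op2 F2 w j ^+ 2 +
    op3 F3 y y j ^+ 2 +
    (rho ^+ 2 + 4 * C ^+ 2 / p ^+ 2) * c * delta ^+ 3 * W j))).
  apply: ler_avg => j; rewrite resE; apply: le_trans (sq4 _ _ _ _) _.
  have [_ _ _ b2] := pb j.
  have H1 : 4 * (rho / (2 * delta) * (y j ^+ 2 - (delta * f j) ^+ 2)) ^+ 2 <=
      rho ^+ 2 * c * delta ^+ 3 * W j.
    rewrite [leLHS](_ : _ = rho ^+ 2 / delta ^+ 2 *
      (y j ^+ 2 - (delta * f j) ^+ 2) ^+ 2); last by field.
    rewrite [leRHS](_ : _ = rho ^+ 2 / delta ^+ 2 * (c * delta ^+ 5 * W j));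
      last by field.
    by rewrite ler_wpM2l// divr_ge0// sqr_ge0.
  have H2 : 4 * (alpha * om j) ^+ 2 <=
      4 * C ^+ 2 / p ^+ 2 * c * delta ^+ 3 * W j.
    rewrite [leLHS](_ : _ = 4 / (p ^+ 2 * delta ^+ 2) * om j ^+ 2); last first.
      by rewrite /alpha; field; rewrite dN0 pN0.
    rewrite [leRHS](_ : _ = 4 / (p ^+ 2 * delta ^+ 2) *
      (C ^+ 2 * (c * delta ^+ 5 * W j))); last by field; rewrite dN0 pN0.
    by rewrite ler_wpM2l// divr_ge0// mulr_ge0// sqr_ge0.
  rewrite [leLHS](_ : _ = 4 * delta ^+ 4 * op2 F2 w j ^+ 2 + op3 F3 y y j ^+ 2 +
    (4 * (rho / (2 * delta) * (y j ^+ 2 - (delta * f j) ^+ 2)) ^+ 2 +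
     4 * (alpha * om j) ^+ 2)); last by field.
  apply: lerD => //.
  rewrite [leRHS](_ : _ = rho ^+ 2 * c * delta ^+ 3 * W j +
    4 * C ^+ 2 / p ^+ 2 * c * delta ^+ 3 * W j); last by ring.
  exact: lerD.
rewrite 2!avgD !avgZ; apply: lerD => //; apply: lerD.
  rewrite ler_wpM2l ?mulr_ge0 ?exprn_ge0 ?(ltW d0)//.
  apply: le_trans (op2_sqr_le _ _) _; rewrite ler_wpM2r//.
  by apply: avg_ge0 => j; exact: sqr_ge0.
apply: le_trans (op3_sqr_le _ _ _) _; rewrite -expr2 ler_wpM2r//.
exact: sqr_ge0.
Qed.

End candidate.

(** * Uniform asymptotics *)

Section landau.
Context (R : realType) (I : Type) (F : set_system I) {FF : Filter F} (e : I -> R).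
Hypothesis e01 : forall i, 0 < e i <= 1.
Hypothesis e_small : forall r : R, 0 < r -> \forall i \near F, e i <= r.
Implicit Types (u v : I -> R) (k l : nat).

(** The filter is arbitrary because an index will be a sample size together with a sample point; [e]
    will be n^(-1/2). *)
Definition bigO k u := exists C : R, \forall i \near F, `|u i| <= C * e i ^+ k.

Let ek0 i k : 0 <= e i ^+ k.
Proof. by case/andP: (e01 i) => /ltW ? _; exact: exprn_ge0. Qed.

Lemma bigO_pos k u : bigO k u ->
  exists2 C : R, 0 < C & \forall i \near F, `|u i| <= C * e i ^+ k.
Proof.
move=> [C uC]; exists (`|C| + 1); first by rewrite ltr_wpDl.
apply: filterS uC => i /le_trans; apply; rewrite ler_wpM2r//.
by rewrite (le_trans (ler_norm C))// lerDl.
Qed.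

Lemma bigO_near k u v : bigO k v -> (\forall i \near F, `|u i| <= `|v i|) ->
  bigO k u.
Proof.
by move=> [C vC] uv; exists C; apply: filterS2 vC uv => i vC /le_trans; apply.
Qed.

Lemma bigO_cst a : bigO 0 (fun=> a).
Proof. by exists `|a|; apply: nearW => i; rewrite expr0 mulr1. Qed.

Lemma bigO_e k : bigO k (fun i => e i ^+ k).
Proof. by exists 1; apply: nearW => i; rewrite mul1r ger0_norm. Qed.

Lemma bigON k u : bigO k u -> bigO k (fun i => - u i).
Proof. by move=> [C uC]; exists C; apply: filterS uC => i; rewrite normrN. Qed.

Lemma bigOD k u v : bigO k u -> bigO k v -> bigO k (fun i => u i + v i).
Proof.
move=> [C uC] [D vD]; exists (C + D); apply: filterS2 uC vD => i uC vD.
by rewrite (le_trans (ler_normD _ _))// mulrDl lerD.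
Qed.

Lemma bigOM k l u v : bigO k u -> bigO l v -> bigO (k + l) (fun i => u i * v i).
Proof.
move=> [C uC] [D vD]; exists (C * D); apply: filterS2 uC vD => i uC vD.
by rewrite normrM exprD mulrACA; apply: ler_pM.
Qed.

Lemma bigO0M u v : bigO 0 u -> bigO 0 v -> bigO 0 (fun i => u i * v i).
Proof. exact: bigOM. Qed.

Lemma bigO0X n u : bigO 0 u -> bigO 0 (fun i => u i ^+ n).
Proof.
move=> Ou; elim: n => [|n IHn]; first exact: bigO_cst.
apply: (bigO_near (bigO0M Ou IHn)).
by apply: nearW => i; rewrite exprS.
Qed.

Lemma bigOeM k u v : bigO 0 u ->
  (\forall i \near F, `|v i| <= e i ^+ k * `|u i|) -> bigO k v.
Proof.
move=> Ou vu; rewrite -(addn0 k); apply: (bigO_near (bigOM (bigO_e k) Ou)).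
by apply: filterS vu => i; rewrite normrM (ger0_norm (ek0 _ _)).
Qed.

Lemma bigO_weaken k l u : (l <= k)%N -> bigO k u -> bigO l u.
Proof.
move=> lk /bigO_pos[C C0 uC]; exists C; apply: filterS uC => i /le_trans; apply.
apply: ler_wpM2l; first exact: ltW.
case/andP: (e01 i) => /ltW ? ?.
exact: ler_wiXn2l.
Qed.

Lemma bigO1_small u r : bigO 1 u -> 0 < r -> \forall i \near F, `|u i| <= r.
Proof.
move=> /bigO_pos[C C0 uC] r0; have := @e_small (r / C) (divr_gt0 r0 C0).
apply: filterS2 uC => i uC er; apply: le_trans uC _.
by rewrite expr1 mulrC -ler_pdivlMr.
Qed.

End landau.

(** Bounded quantities are closed under the ring operations, so boundedness is decided by syntax.
    Positive orders are reduced to this case by first factoring out an explicit power of [e] with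
    [bigOeM]. *)
Ltac solve_bigO0 := repeat match goal with
  | H : bigO _ _ ?k ?u |- bigO _ _ ?k ?u => exact H
  | |- bigO _ _ 0 (fun i => _ + _) => apply: bigOD
  | |- bigO _ _ 0 (fun i => - _) => apply: bigON
  | |- bigO _ _ 0 (fun i => _ ^+ _) => apply: bigO0X
  | |- bigO _ _ 0 (fun i => _ * _) => apply: bigO0M
  | |- bigO _ _ 0 (fun i => _) => exact: bigO_cst
  | |- _ => eassumption
  end.

(** * The step length determined by the constraint *)

Section step_size.
Context (R : realType).
Variables (p p3 p4 kap gam m4 m2a m2b m2c m3c c e : R).
Hypotheses (p0 : p != 0) (k0 : kap != 0) (c0 : c != 0).

Let A := p * m2c - p3 / 3 * gam.
Let B := p / 2 * m2a - p3 ^+ 2 / (8 * p) * (m4 - kap ^+ 2) + p4 / 24 * m4.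
Let rho := p3 / p.
Let g2 := 3 / 2 * m2c - rho / 2 * gam.
Let g3 := m2a - rho / 2 * m2b + 1 / 6 * m3c.

(* Coefficients in e of the step length [e * (c + d1 e + d2 e ^ 2)] for which
   the divergence of the candidate is [c ^ 2 p kap e ^ 2 / 2] to order e ^ 4. *)
Definition step1 := - (A * c ^+ 2 / (p * kap)).
Definition step2 := 5 / 2 * step1 ^+ 2 / c - B * c ^+ 3 / (p * kap).

Definition step_tail := step1 + step2 * e.
Definition step := c + e * step_tail.

Let d1 := step1.
Let d2 := step2.
Let tau := step_tail.

(** [step1] and [step2] solve the equations that the e^3 and e^4 coefficients vanish; the 5 / 2 in
    [step2] is 3 - 1 / 2, from the cubic and the quadratic term. Expressing A and B through them
    leaves a polynomial identity in the two coefficients. The tail is explicit because it has to be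
    bounded. *)
Lemma step_divergence :
  p / 2 * kap * (e * step) ^+ 2 + A * (e * step) ^+ 3 + B * (e * step) ^+ 4 =
  c ^+ 2 * p * kap / 2 * e ^+ 2 +
  e ^+ 5 * (p * kap / 2 * (2 * d1 * d2 + d2 ^+ 2 * e) +
    A * (3 * c ^+ 2 * d2 + 3 * c * tau ^+ 2 + e * tau ^+ 3) +
    B * (4 * c ^+ 3 * tau + 6 * c ^+ 2 * e * tau ^+ 2 +
      4 * c * e ^+ 2 * tau ^+ 3 + e ^+ 3 * tau ^+ 4)).
Proof.
have HA : A = - (d1 * p * kap) / c ^+ 2.
  by rewrite /d1 /step1; field; rewrite p0 k0 c0.
have HB : B = (5 / 2 * d1 ^+ 2 / c - d2) * (p * kap) / c ^+ 3.
  by rewrite /d2 /step2 -/d1; field; rewrite p0 k0 c0.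
rewrite /step /tau /step_tail -/d1 -/d2 HA HB; move: d1 d2 => x1 x2.
by field.
Qed.

(** The coefficients of the theorem arise here: [E2] and [E3] combine the corrections of the step
    length with the higher-order terms of the value. *)
Lemma step_value :
  (e * step) * kap + (e * step) ^+ 2 * g2 + (e * step) ^+ 3 * g3 =
  e * (c * kap) +
  e ^+ 2 * c ^+ 2 * (- (1 / 6) * (p3 * gam / p) + 1 / 2 * m2c) +
  e ^+ 3 * c ^+ 3 * (1 / 6 * m3c - 1 / 2 * (p3 / p) * m2b +
    p3 / (3 * kap * p) * gam * m2c +
    (p3 ^+ 2 / (8 * p ^+ 2) - 1 / 24 * (p4 / p)) * m4 + 1 / 2 * m2a -
    p3 ^+ 2 / (18 * p ^+ 2 * kap) * gam ^+ 2 -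
    p3 ^+ 2 / (8 * p ^+ 2) * kap ^+ 2 - 1 / (2 * kap) * m2c ^+ 2) +
  e ^+ 4 * (g2 * (2 * c * d2 + tau ^+ 2) +
    g3 * (3 * c ^+ 2 * tau + 3 * c * e * tau ^+ 2 + e ^+ 2 * tau ^+ 3)).
Proof.
have -> : e * step * kap = e * (c * kap) + e ^+ 2 * (d1 * kap) + e ^+ 3 * (d2 * kap).
  by rewrite /step /step_tail -/d1 -/d2; ring.
have E2 : d1 * kap + c ^+ 2 * g2 =
    c ^+ 2 * (- (1 / 6) * (p3 * gam / p) + 1 / 2 * m2c).
  by rewrite /d1 /step1 /A /g2 /rho; field; rewrite p0 k0.
have E3 : d2 * kap + 2 * c * d1 * g2 + c ^+ 3 * g3 = c ^+ 3 *
   (1 / 6 * m3c - 1 / 2 * (p3 / p) * m2b +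
    p3 / (3 * kap * p) * gam * m2c +
    (p3 ^+ 2 / (8 * p ^+ 2) - 1 / 24 * (p4 / p)) * m4 + 1 / 2 * m2a -
    p3 ^+ 2 / (18 * p ^+ 2 * kap) * gam ^+ 2 -
    p3 ^+ 2 / (8 * p ^+ 2) * kap ^+ 2 - 1 / (2 * kap) * m2c ^+ 2).
  rewrite /d2 /step2 /d1 /step1 /A /B /g2 /g3 /rho.
  by field; rewrite p0 k0 c0.
rewrite -(mulrA (e ^+ 2)) -E2 -(mulrA (e ^+ 3)) -E3.
rewrite /step /tau /step_tail -/d1 -/d2; move: d1 d2 g2 g3 => x1 x2 x3 x4.
by ring.
Qed.

End step_size.

(** The sum of the three terms of the theorem written as a polynomial in [e], so that passing to the
    minimum amounts to replacing [e] by [- e]. *)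
Definition optimum_expansion (R : realType) (m : nat) (q p p3 p4 e : R)
    (f : 'I_m.+1 -> R) (F2 : 'I_m.+1 -> 'I_m.+1 -> R)
    (F3 : 'I_m.+1 -> 'I_m.+1 -> 'I_m.+1 -> R) : R :=
  let g := op2 F2 f in
  let kap := avg (fun j => f j ^+ 2) in
  let gam := avg (fun j => f j ^+ 3) in
  let m4 := avg (fun j => f j ^+ 4) in
  let m2a := avg (fun j => g j ^+ 2) in
  let m2b := avg (fun j => f j ^+ 2 * g j) in
  let m2c := avg (fun j => f j * g j) in
  let m3c := form3 F3 f f f in
  let c := Num.sqrt (q / (p * kap)) in
  e * (c * kap) +
  e ^+ 2 * c ^+ 2 * (- (1 / 6) * (p3 * gam / p) + 1 / 2 * m2c) +
  e ^+ 3 * c ^+ 3 * (1 / 6 * m3c - 1 / 2 * (p3 / p) * m2b +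
    p3 / (3 * kap * p) * gam * m2c +
    (p3 ^+ 2 / (8 * p ^+ 2) - 1 / 24 * (p4 / p)) * m4 + 1 / 2 * m2a -
    p3 ^+ 2 / (18 * p ^+ 2 * kap) * gam ^+ 2 -
    p3 ^+ 2 / (8 * p ^+ 2) * kap ^+ 2 - 1 / (2 * kap) * m2c ^+ 2).

(** * Optimum of the cubic expansion, uniformly along a filter *)

Section family.
Context (R : realType) (phi dphi : R -> R) (q p p3 p4 eta C dl D : R).
Hypotheses (q_gt0 : 0 < q) (p_gt0 : 0 < p).
Hypothesis tphi : tame_divergence phi dphi q p p3 p4 eta C dl D.
Context (I : Type) (F : set_system I) {FF : Filter F} (m : I -> nat).
Variables (f : forall i, 'I_(m i).+1 -> R).
Variables (F2 : forall i, 'I_(m i).+1 -> 'I_(m i).+1 -> R).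
Variables (F3 : forall i, 'I_(m i).+1 -> 'I_(m i).+1 -> 'I_(m i).+1 -> R).

Let e i : R := Num.sqrt ((m i).+1%:R^-1).
Local Notation O := (bigO F e).

Hypothesis e_small : forall r : R, 0 < r -> \forall i \near F, e i <= r.
Hypothesis F_sym : \forall i \near F,
  [/\ forall j k, @F2 i k j = @F2 i j k,
      forall j k l, @F3 i k j l = @F3 i j k l &
      forall j k l, @F3 i j l k = @F3 i j k l].
Hypothesis F_centered : \forall i \near F,
  avg (@f i) = 0 /\ forall k, avg (fun j => @F2 i j k) = 0.
Hypothesis f5 : O 0 (fun i => avg (fun j => `|@f i j| ^+ 5)).
Hypothesis F25 : O 0 (fun i => avg (fun j => avg (fun k => `|@F2 i j k| ^+ 5))).
Hypothesis F35 : O 0 (fun i => avg (fun j => avg (fun k => avg (fun l =>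
  `|@F3 i j k l| ^+ 5)))).
Hypothesis kap_gt0 : \forall i \near F, 0 < avg (fun j => @f i j ^+ 2).
Hypothesis kapV : O 0 (fun i => (avg (fun j => @f i j ^+ 2))^-1).

Let g i := op2 (@F2 i) (@f i).
Let kap i := avg (fun j => @f i j ^+ 2).
Let gam i := avg (fun j => @f i j ^+ 3).
Let m4 i := avg (fun j => @f i j ^+ 4).
Let m2a i := avg (fun j => @g i j ^+ 2).
Let m2b i := avg (fun j => @f i j ^+ 2 * @g i j).
Let m2c i := avg (fun j => @f i j * @g i j).
Let m3c i := form3 (@F3 i) (@f i) (@f i) (@f i).
Let A2 i := avg (fun j => avg (fun k => @F2 i j k ^+ 2)).
Let A3 i := avg (fun j => avg (fun k => avg (fun l => @F3 i j k l ^+ 2))).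
Let rho := p3 / p.
Let w i := second_order p p3 (@f i) (@F2 i) (kap i).
Let b i j := @g i j + rho / 2 * kap i.

Let e01 i : 0 < e i <= 1.
Proof.
rewrite sqrtr_gt0 invr_gt0 ltr0n/= -[leRHS]sqrtr1 ler_wsqrtr// invf_le1 ?ltr0n//.
by rewrite ler1n.
Qed.

Let e2 i : e i ^+ 2 = (m i).+1%:R^-1.
Proof. by rewrite sqr_sqrtr. Qed.

Let O_avg (u v : forall i, 'I_(m i).+1 -> R) :
  (forall i j, `|@u i j| <= @v i j) -> O 0 (fun i => avg (@v i)) ->
  O 0 (fun i => avg (@u i)).
Proof.
move=> uv /bigO_near; apply; apply: nearW => i.
apply: le_trans (ler_norm_avg _) _.
by apply: le_trans (ler_norm _); exact: ler_avg.
Qed.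

Let O_le (u v : I -> R) : (forall i, `|u i| <= v i) -> O 0 v -> O 0 u.
Proof.
move=> uv /bigO_near; apply; apply: nearW => i.
by apply: le_trans (uv i) _; exact: ler_norm.
Qed.

Let O_sqr (u : I -> R) : O 0 (fun i => u i ^+ 2) -> O 0 u.
Proof.
move=> Ou; apply: (@O_le _ (fun i => 1 + u i ^+ 2)); last by solve_bigO0.
move=> i; rewrite -[u i ^+ 2]real_normK ?num_real//.
by have := sqr_ge0 (`|u i| - 1); have := normr_ge0 (u i); nra.
Qed.

Let kapO : O 0 (fun i => kap i).
Proof.
apply: (@O_avg _ (fun i j => 1 + `|@f i j| ^+ 5)) => [i j|].
  by rewrite ger0_norm ?sqr_ge0// sqr_le_pow5.
apply: (@O_le _ (fun i => 1 + avg (fun j => `|@f i j| ^+ 5))); last by solve_bigO0.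
by move=> i; rewrite avgD avg_cst ger0_norm// addr_ge0// avg_ge0.
Qed.

Let m4O : O 0 (fun i => m4 i).
Proof.
apply: (@O_avg _ (fun i j => 1 + `|@f i j| ^+ 5)) => [i j|].
  by rewrite ger0_norm ?exprn_even_ge0// pow4_le_pow5.
apply: (@O_le _ (fun i => 1 + avg (fun j => `|@f i j| ^+ 5))); last by solve_bigO0.
by move=> i; rewrite avgD avg_cst ger0_norm// addr_ge0// avg_ge0.
Qed.

Let gamO : O 0 (fun i => gam i).
Proof.
apply: (@O_avg _ (fun i j => @f i j ^+ 2 + @f i j ^+ 4)) => [i j|].
  by rewrite ler_norml; apply/andP; split;
    have := sqr_ge0 (@f i j * (@f i j - 1)); have := sqr_ge0 (@f i j * (@f i j + 1));
    have := sqr_ge0 (@f i j); have := sqr_ge0 (@f i j ^+ 2); nra.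
apply: (@O_le _ (fun i => kap i + m4 i)); last by solve_bigO0.
move=> i; rewrite avgD -/(kap i) -/(m4 i) ger0_norm// addr_ge0//; apply: avg_ge0 => j.
  exact: sqr_ge0.
exact: exprn_even_ge0.
Qed.

Let A2O : O 0 (fun i => A2 i).
Proof.
apply: (@O_avg _ (fun i j => 1 + avg (fun k => `|@F2 i j k| ^+ 5))) => [i j|].
  rewrite ger0_norm; last by apply: avg_ge0 => k; exact: sqr_ge0.
  rewrite -{1}(@avg_cst R (m i) 1) -avgD; apply: ler_avg => k; exact: sqr_le_pow5.
apply: (@O_le _ (fun i => 1 + avg (fun j => avg (fun k => `|@F2 i j k| ^+ 5)))).
  move=> i; rewrite avgD avg_cst ger0_norm// addr_ge0//.
  by do 2!apply: avg_ge0 => ?; exact: exprn_ge0.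
by solve_bigO0.
Qed.

Let A24O : O 0 (fun i => avg (fun j => avg (fun k => @F2 i j k ^+ 4))).
Proof.
apply: (@O_avg _ (fun i j => 1 + avg (fun k => `|@F2 i j k| ^+ 5))) => [i j|].
  rewrite ger0_norm; last by apply: avg_ge0 => k; exact: exprn_even_ge0.
  rewrite -{1}(@avg_cst R (m i) 1) -avgD; apply: ler_avg => k; exact: pow4_le_pow5.
apply: (@O_le _ (fun i => 1 + avg (fun j => avg (fun k => `|@F2 i j k| ^+ 5)))).
  move=> i; rewrite avgD avg_cst ger0_norm// addr_ge0//.
  by do 2!apply: avg_ge0 => ?; exact: exprn_ge0.
by solve_bigO0.
Qed.

Let A3O : O 0 (fun i => A3 i).
Proof.
apply: (@O_avg _ (fun i j => 1 + avg (fun k => avg (fun l => `|@F3 i j k l| ^+ 5))))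
  => [i j|].
  rewrite ger0_norm; last by do 2!apply: avg_ge0 => ?; exact: sqr_ge0.
  rewrite -{1}(@avg_cst R (m i) 1) -avgD; apply: ler_avg => k.
  rewrite -{1}(@avg_cst R (m i) 1) -avgD; apply: ler_avg => l; exact: sqr_le_pow5.
apply: (@O_le _ (fun i => 1 + avg (fun j => avg (fun k => avg (fun l =>
    `|@F3 i j k l| ^+ 5))))).
  move=> i; rewrite avgD avg_cst ger0_norm// addr_ge0//.
  by do 3!apply: avg_ge0 => ?; exact: exprn_ge0.
by solve_bigO0.
Qed.

Let g4O : O 0 (fun i => avg (fun j => @g i j ^+ 4)).
Proof.
apply: (@O_le _ (fun i => kap i ^+ 2 * avg (fun j => avg (fun k => @F2 i j k ^+ 4))));
  last by solve_bigO0.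
move=> i; rewrite ger0_norm; last by apply: avg_ge0 => j; exact: exprn_even_ge0.
rewrite -avgZ; apply: ler_avg => j.
rewrite (_ : _ ^+ 4 = (@g i j ^+ 2) ^+ 2); last by rewrite -exprM.
apply: (@le_trans _ _ ((kap i * avg (fun k => @F2 i j k ^+ 2)) ^+ 2)).
  rewrite lerXn2r ?nnegrE ?sqr_ge0//; last exact: avg_cauchy_schwarz.
  by apply: mulr_ge0; apply: avg_ge0 => k; exact: sqr_ge0.
rewrite exprMn ler_wpM2l ?sqr_ge0//; apply: le_trans (avg_sqr_le _) _.
by apply: ler_avg => k; rewrite -exprM.
Qed.

Let m2aO : O 0 (fun i => m2a i).
Proof.
apply: (@O_le _ (fun i => A2 i * kap i)); last by solve_bigO0.
move=> i; rewrite ger0_norm ?op2_sqr_le//; apply: avg_ge0 => j; exact: sqr_ge0.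
Qed.

Let m2bO : O 0 (fun i => m2b i).
Proof.
apply: (@O_avg _ (fun i j => @f i j ^+ 4 + @g i j ^+ 2)) => [i j|].
  rewrite ler_norml; apply/andP; split;
    have := sqr_ge0 (@f i j ^+ 2 - @g i j); have := sqr_ge0 (@f i j ^+ 2 + @g i j);
    have := sqr_ge0 (@f i j ^+ 2); have := sqr_ge0 (@g i j); nra.
apply: (@O_le _ (fun i => m4 i + m2a i)); last by solve_bigO0.
move=> i; rewrite avgD -/(m2a i) -/(m4 i) ger0_norm// addr_ge0//; apply: avg_ge0 => j.
  exact: exprn_even_ge0.
exact: sqr_ge0.
Qed.

Let m2cO : O 0 (fun i => m2c i).
Proof.
apply: O_sqr; apply: (@O_le _ (fun i => kap i * m2a i)); last by solve_bigO0.
by move=> i; rewrite ger0_norm ?sqr_ge0// avg_cauchy_schwarz.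
Qed.

Let m3cO : O 0 (fun i => m3c i).
Proof.
apply: O_sqr; apply: (@O_le _ (fun i => A3 i * (kap i * (kap i * kap i)))).
  by move=> i; rewrite ger0_norm ?sqr_ge0// form3_sqr_le.
by solve_bigO0.
Qed.

Let w2O : O 0 (fun i => avg (fun j => @w i j ^+ 2)).
Proof.
apply: (@O_avg _ (fun i j => 2 * @g i j ^+ 2 + rho ^+ 2 * @f i j ^+ 4 +
    rho ^+ 2 * kap i ^+ 2)) => [i j|].
  rewrite ger0_norm ?sqr_ge0// /w /second_order -/(@g i) -/rho -subr_ge0.
  rewrite (_ : _ - _ = (@g i j + rho / 2 * (@f i j ^+ 2 - kap i)) ^+ 2 +
    rho ^+ 2 / 2 * (@f i j ^+ 2 + kap i) ^+ 2); last by field.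
  by rewrite addr_ge0 ?sqr_ge0// mulr_ge0 ?sqr_ge0// divr_ge0 ?sqr_ge0.
apply: (@O_le _ (fun i => 2 * m2a i + rho ^+ 2 * m4 i + rho ^+ 2 * kap i ^+ 2)).
  move=> i; rewrite !avgD !avgZ avg_cst -/(m2a i) -/(m4 i) ger0_norm//.
  have a0 : 0 <= m2a i by apply: avg_ge0 => j; exact: sqr_ge0.
  have b0 : 0 <= m4 i by apply: avg_ge0 => j; exact: exprn_even_ge0.
  by rewrite !addr_ge0// mulr_ge0// sqr_ge0.
by solve_bigO0.
Qed.

Let b4O : O 0 (fun i => avg (fun j => @b i j ^+ 4)).
Proof.
apply: (@O_avg _ (fun i j => 8 * @g i j ^+ 4 + 8 * (rho / 2 * kap i) ^+ 4)) => [i j|].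
  rewrite ger0_norm ?exprn_even_ge0// /b; move: (@g i j) (_ * kap i) => s t.
  have H1 : (s + t) ^+ 2 <= 2 * s ^+ 2 + 2 * t ^+ 2.
    by have := sqr_ge0 (s - t); nra.
  have H2 : (s + t) ^+ 4 <= (2 * s ^+ 2 + 2 * t ^+ 2) ^+ 2.
    rewrite (_ : _ ^+ 4 = ((s + t) ^+ 2) ^+ 2); last by rewrite -exprM.
    by rewrite lerXn2r ?nnegrE ?sqr_ge0// (le_trans _ H1)// sqr_ge0.
  apply: le_trans H2 _; rewrite -subr_ge0.
  rewrite (_ : _ - _ = 4 * (s ^+ 2 - t ^+ 2) ^+ 2); last by ring.
  by rewrite mulr_ge0// sqr_ge0.
apply: (@O_le _ (fun i => 8 * avg (fun j => @g i j ^+ 4) + 8 * (rho / 2 * kap i) ^+ 4));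
  last by solve_bigO0.
move=> i; rewrite avgD avgZ avg_cst ger0_norm// addr_ge0// mulr_ge0//.
  by apply: avg_ge0 => j; exact: exprn_even_ge0.
exact: exprn_even_ge0.
Qed.

Let W i j := 1 + `|@f i j| ^+ 5 + @b i j ^+ 4.

Let WO : O 0 (fun i => avg (@W i)).
Proof.
apply: (@O_le _ (fun i => 1 + avg (fun j => `|@f i j| ^+ 5) +
  avg (fun j => @b i j ^+ 4))); last by solve_bigO0.
move=> i; rewrite 2!avgD avg_cst ger0_norm// !addr_ge0//; apply: avg_ge0 => j.
  exact: exprn_ge0.
exact: exprn_even_ge0.
Qed.

Let kap_ge0 i : 0 <= kap i.
Proof. by apply: avg_ge0 => j; exact: sqr_ge0. Qed.

Let c i := Num.sqrt (q / (p * kap i)).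

Let pkV : O 0 (fun i => (p * kap i)^-1).
Proof.
apply: (@bigO_near _ _ _ FF _ _ _ (fun i => p^-1 * (kap i)^-1)); last first.
  by apply: nearW => i; rewrite invfM.
by solve_bigO0.
Qed.

Let c2 i : c i ^+ 2 = q / (p * kap i).
Proof.
by rewrite sqr_sqrtr// divr_ge0 ?(ltW q_gt0)// mulr_ge0 ?kap_ge0// (ltW p_gt0).
Qed.

Let cO : O 0 (fun i => c i).
Proof.
apply: O_sqr; apply: (@O_le _ (fun i => q / (p * kap i))); last by solve_bigO0.
by move=> i; rewrite ger0_norm ?sqr_ge0// c2.
Qed.

Let cVO : O 0 (fun i => (c i)^-1).
Proof.
apply: O_sqr; apply: (@O_le _ (fun i => p * kap i / q)); last by solve_bigO0.
by move=> i; rewrite ger0_norm ?sqr_ge0// exprVn c2 invf_div.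
Qed.

Let c_gt0 : \forall i \near F, 0 < c i.
Proof.
by apply: filterS kap_gt0 => i k0; rewrite sqrtr_gt0 divr_gt0// mulr_gt0.
Qed.

Let d1 i := step1 p p3 (kap i) (gam i) (m2c i) (c i).
Let d2 i := step2 p p3 p4 (kap i) (gam i) (m4 i) (m2a i) (m2c i) (c i).
Let tau i := step_tail p p3 p4 (kap i) (gam i) (m4 i) (m2a i) (m2c i) (c i) (e i).
Let sg i := step p p3 p4 (kap i) (gam i) (m4 i) (m2a i) (m2c i) (c i) (e i).

Let eO : O 0 (fun i => e i).
Proof.
by apply: (bigO_near (bigO_weaken e01 (leq0n 1) (bigO_e e01 1))); exact: nearW.
Qed.

Let d1O : O 0 (fun i => d1 i).
Proof. rewrite /d1 /step1; solve_bigO0. Qed.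

Let d2O : O 0 (fun i => d2 i).
Proof. rewrite /d2 /step2 /step1; solve_bigO0. Qed.

Let tauO : O 0 (fun i => tau i).
Proof. rewrite /tau /step_tail; solve_bigO0. Qed.

Let sgO : O 0 (fun i => sg i).
Proof. rewrite /sg /step; solve_bigO0. Qed.

(** A bound M for 1 / c keeps c above 1 / M, while the correction e tau is eventually below 1 / (2
    M). A lower bound is needed because alpha contains 1 / delta. *)
Let sg_ge : \forall i \near F, c i / 2 <= sg i.
Proof.
have [M M0 cM] := bigO_pos e01 cVO.
have O1 : O 1 (fun i => e i * tau i).
  by apply: (bigOeM e01 tauO); apply: nearW => i; rewrite normrM expr1 ger0_norm//;
    case/andP: (e01 i) => /ltW.
have r0 : 0 < M^-1 / 2 by rewrite divr_gt0// invr_gt0.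
have et := bigO1_small (FF := FF) e01 e_small O1 r0.
apply: filterS3 cM c_gt0 et => i cM cp.
rewrite expr0 mulr1 ger0_norm ?invr_ge0 ?(ltW cp)// in cM.
have : M^-1 <= c i by rewrite -[leRHS]invrK lef_pV2// posrE invr_gt0.
rewrite ler_norml /sg /step -/(tau i); lra.
Qed.

Let sgVO : O 0 (fun i => (sg i)^-1).
Proof.
have H : O 0 (fun i => 2 * (c i)^-1) by solve_bigO0.
apply: (bigO_near H); apply: filterS2 sg_ge c_gt0 => i sc cp.
have c20 : 0 < c i / 2 by rewrite divr_gt0.
have s0 : 0 < sg i := lt_le_trans c20 sc.
rewrite !ger0_norm ?mulr_ge0 ?invr_ge0 ?(ltW cp) ?(ltW s0)//.
by rewrite -[2 * _]invrK invfM invrK [2^-1 * _]mulrC lef_pV2.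
Qed.

Let dta i := e i * sg i.

Let dta_small r : 0 < r -> \forall i \near F, 0 < dta i <= r.
Proof.
move=> r0; have O1 : O 1 dta.
  by apply: (bigOeM e01 sgO); apply: nearW => i; rewrite normrM expr1 ger0_norm//;
    case/andP: (e01 i) => /ltW.
apply: filterS3 (bigO1_small (FF := FF) e01 e_small O1 r0) sg_ge c_gt0 => i dr sc cp.
rewrite (le_trans (ler_norm _) dr) andbT mulr_gt0//; first by case/andP: (e01 i).
by rewrite (lt_le_trans _ sc)// divr_gt0.
Qed.

(** The largest v^4 is at most n times the average, and [dta]^4 is of order n^(-2), which leaves a
    factor n^(-1) even though v itself may grow. *)
Let sup_small (v : forall i, 'I_(m i).+1 -> R) r :
  O 0 (fun i => avg (fun j => @v i j ^+ 4)) -> 0 < r ->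
  \forall i \near F, forall j, dta i * `|@v i j| <= r.
Proof.
move=> v4 r0.
have O2 : O 0 (fun i => e i * (sg i ^+ 4 * avg (fun j => @v i j ^+ 4))) by solve_bigO0.
have O1 : O 1 (fun i => e i ^+ 2 * (sg i ^+ 4 * avg (fun j => @v i j ^+ 4))).
  apply: (bigOeM e01 O2); apply: nearW => i; rewrite expr1 expr2 -mulrA normrM.
  by rewrite (@ger0_norm _ (e i))//; case/andP: (e01 i) => /ltW.
have r4 : 0 < r ^+ 4 by rewrite exprn_gt0.
apply: filterS2 (bigO1_small (FF := FF) e01 e_small O1 r4) (dta_small ltr01) => i.
move=> er /andP[d0 _] j.
have dv0 : 0 <= dta i * `|@v i j| by apply: mulr_ge0 => //; exact: ltW.
rewrite -(@ler_pXn2r _ 4)// ?nnegrE ?(ltW r0)//.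
apply: le_trans er; apply: le_trans (ler_norm _).
have -> : (dta i * `|@v i j|) ^+ 4 = e i ^+ 2 * (sg i ^+ 4 * (e i ^+ 2 * @v i j ^+ 4)).
  rewrite exprMn -normrX (@ger0_norm _ (@v i j ^+ 4)) ?exprn_even_ge0// /dta.
  by ring.
rewrite ler_wpM2l ?sqr_ge0// ler_wpM2l ?exprn_even_ge0// e2.
rewrite ler_pdivrMl ?ltr0n//; apply: (ler_term_avg (f := fun j => @v i j ^+ 4)).
by move=> k; exact: exprn_even_ge0.
Qed.

Let y i := candidate p p3 (@f i) (@F2 i) (kap i) (dta i).
Let G i := cubic_expansion (@f i) (@F2 i) (@F3 i).
Let K := 1 + `|rho|.

Let K1 : 1 <= K. Proof. by rewrite lerDl. Qed.

Let f4O : O 0 (fun i => avg (fun j => @f i j ^+ 4)). Proof. exact: m4O. Qed.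

Let y_small : \forall i \near F, forall j, `|@y i j| <= eta.
Proof.
case/andP: (tame_eta tphi) => eta0 eta1.
(* The first-order part of y is at most r and the second-order part at most K (r + r), using r <= 1;
   together they give eta. *)
pose r := eta / (1 + 2 * K).
have K2 : 0 < 1 + 2 * K by have := K1; lra.
have r0 : 0 < r by rewrite divr_gt0.
have r1 : r <= 1.
  by rewrite ler_pdivrMr//; have := K1; lra.
apply: filterS3 (sup_small f4O r0) (sup_small b4O r0) (dta_small ltr01).
move=> i fr br /andP[d0 d1'] j; rewrite /y /candidate -/(@w i).
have wE : @w i j = @b i j - rho / 2 * @f i j ^+ 2.
  by rewrite /w /second_order /b -/(@g i) -/rho; ring.
apply: le_trans (ler_normD _ _) _.
rewrite normrM (ger0_norm (ltW d0)) normrM (@ger0_norm _ (dta i ^+ 2)) ?sqr_ge0//.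
have H1 : dta i ^+ 2 * `|@w i j| <= K * (r + r).
  apply: (@le_trans _ _ (K * (dta i * (dta i * `|@b i j|) + (dta i * `|@f i j|) ^+ 2))).
    rewrite [leRHS](_ : _ = dta i ^+ 2 * (K * (`|@b i j| + `|@f i j| ^+ 2))); last by ring.
    rewrite ler_wpM2l ?sqr_ge0// wE (le_trans (ler_normB _ _))//.
    rewrite normrM normrX normrM (@ger0_norm _ 2^-1)// /K.
    have u0 := normr_ge0 (@b i j); have v0 := sqr_ge0 `|@f i j|.
    have p0 := normr_ge0 rho.
    by have := mulr_ge0 p0 u0; have := mulr_ge0 p0 v0; lra.
  have K0 : 0 <= K by have := K1; lra.
  rewrite ler_wpM2l// lerD//.
    rewrite (le_trans _ (br j))// ler_piMl// mulr_ge0// ltW//.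
  have x0 : 0 <= dta i * `|@f i j| by rewrite mulr_ge0// ltW.
  by rewrite (le_trans _ (fr j))// expr2 ler_piMl// (le_trans (fr j)).
apply: le_trans (lerD (fr j) H1) _.
by rewrite [leLHS](_ : _ = r * (1 + 2 * K)); [rewrite /r divfK ?gt_eqF//|ring].
Qed.

Let ck := 1024 * K ^+ 5.

(* the remainder of [step_divergence] *)
Let div_tail i :=
  let A := p * m2c i - p3 / 3 * gam i in
  let B := p / 2 * m2a i - p3 ^+ 2 / (8 * p) * (m4 i - kap i ^+ 2) + p4 / 24 * m4 i in
  p * kap i / 2 * (2 * d1 i * d2 i + d2 i ^+ 2 * e i) +
  A * (3 * c i ^+ 2 * d2 i + 3 * c i * tau i ^+ 2 + e i * tau i ^+ 3) +
  B * (4 * c i ^+ 3 * tau i + 6 * c i ^+ 2 * e i * tau i ^+ 2 +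
    4 * c i * e i ^+ 2 * tau i ^+ 3 + e i ^+ 3 * tau i ^+ 4).

Let S i := `|div_tail i| + (C + `|p3| + `|p4|) * ck * `|sg i| ^+ 5 * avg (@W i).

Let O_norm (u : I -> R) : O 0 (fun i => u i) -> O 0 (fun i => `|u i|).
Proof. by move/bigO_near; apply; apply: nearW => i; rewrite normr_id. Qed.

Let SO : O 0 (fun i => S i).
Proof.
have H1 : O 0 (fun i => `|div_tail i|) by apply: O_norm; rewrite /div_tail; solve_bigO0.
have H2 : O 0 (fun i => `|sg i|) by exact: O_norm.
rewrite /S; solve_bigO0.
Qed.

Let df_le1 : \forall i \near F, forall j, dta i * `|@f i j| <= 1.
Proof. exact: sup_small f4O ltr01. Qed.

Let db_le1 : \forall i \near F, forall j, dta i * `|@b i j| <= 1.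
Proof. exact: sup_small b4O ltr01. Qed.

Let divergence_y : \forall i \near F,
  `|avg (fun j => phi (1 + @y i j)) - q / (2 * (m i).+1%:R)| <= e i ^+ 5 * S i.
Proof.
near=> i.
have d01 : 0 < dta i <= 1 by near: i; exact: dta_small.
have cp : 0 < c i by near: i; exact: c_gt0.
have kp : 0 < kap i by near: i; exact: kap_gt0.
have [f0 F20] : avg (@f i) = 0 /\ forall k, avg (fun j => @F2 i j k) = 0.
  by near: i; exact: F_centered.
have df1 : forall j, dta i * `|@f i j| <= 1 by near: i; exact: df_le1.
have db1 : forall j, dta i * `|@b i j| <= 1 by near: i; exact: db_le1.
have ye : forall j, `|@y i j| <= eta by near: i; exact: y_small.
have H := @candidate_divergence R phi dphi q p p3 p4 eta C dl D p_gt0 tphi (m i)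
  (@f i) (@F2 i) f0 F20 (kap i) (dta i) erefl d01 df1 db1 ye.
have E := @step_divergence R p p3 p4 (kap i) (gam i) (m4 i) (m2a i) (m2c i)
  (c i) (e i) (lt0r_neq0 p_gt0) (lt0r_neq0 kp) (lt0r_neq0 cp).
have qE : q / (2 * (m i).+1%:R) = c i ^+ 2 * p * kap i / 2 * e i ^+ 2.
  by rewrite c2 e2; field; rewrite !gt_eqF.
have {}E : p / 2 * kap i * dta i ^+ 2 + (p * m2c i - p3 / 3 * gam i) * dta i ^+ 3 +
     (p / 2 * m2a i - p3 ^+ 2 / (8 * p) * (m4 i - kap i ^+ 2) + p4 / 24 * m4 i) *
     dta i ^+ 4 = q / (2 * (m i).+1%:R) + e i ^+ 5 * div_tail i.
  by rewrite qE; exact: E.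
have e0 : 0 <= e i by case/andP: (e01 i) => /ltW.
set X := avg _ in H *; rewrite (_ : X - _ = (X - (q / (2 * (m i).+1%:R) +
  e i ^+ 5 * div_tail i)) + e i ^+ 5 * div_tail i); last by ring.
apply: le_trans (ler_normD _ _) _; rewrite /S [leRHS]mulrDr [leLHS]addrC; apply: lerD.
  by rewrite normrM ger0_norm// exprn_ge0.
rewrite -E; apply: le_trans H _.
rewrite le_eqVlt; apply/orP; left; apply/eqP; rewrite -/ck -/rho -/(@W i).
have -> : dta i ^+ 5 = e i ^+ 5 * `|sg i| ^+ 5.
  rewrite /dta exprMn ger0_norm//; case/andP: d01 => + _.
  rewrite /dta pmulr_rgt0; first exact: ltW.
  by case/andP: (e01 i).
by ring.
Unshelve. all: by end_near. Qed.

Let w2 i := avg (fun j => @w i j ^+ 2).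
Let Y i := 2 * (kap i + w2 i).

Let w2_ge0 i : 0 <= w2 i.
Proof. by apply: avg_ge0 => j; exact: sqr_ge0. Qed.

Let Y_ge0 i : 0 <= Y i.
Proof. by rewrite mulr_ge0// addr_ge0. Qed.

Let YO : O 0 (fun i => Y i).
Proof. rewrite /Y; solve_bigO0. Qed.

Let y2_le i : 0 < dta i <= 1 -> avg (fun j => @y i j ^+ 2) <= dta i ^+ 2 * Y i.
Proof.
move=> /andP[d0 d1']; rewrite /Y mulrA mulrDr /kap /w2 -!avgZ -avgD.
apply: ler_avg => j; rewrite /y /candidate -/(@w i); move: (@f i j) (@w i j) => s t.
have H : (dta i * s + dta i ^+ 2 * t) ^+ 2 <=
    2 * (dta i * s) ^+ 2 + 2 * (dta i ^+ 2 * t) ^+ 2.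
  by have := sqr_ge0 (dta i * s - dta i ^+ 2 * t); nra.
apply: le_trans H _.
have H2 : dta i ^+ 2 * (dta i ^+ 2 * t ^+ 2) <= dta i ^+ 2 * t ^+ 2.
  apply: ler_piMl; first by apply: mulr_ge0; exact: sqr_ge0.
  by apply: exprn_ile1 => //; exact: ltW.
by move: H2; move: (dta i) => d H2; lra.
Qed.

Let V i := optimum_expansion q p p3 p4 (e i) (@f i) (@F2 i) (@F3 i).

Let O_form3 (u v z : forall i, 'I_(m i).+1 -> R) :
  O 0 (fun i => avg (fun j => @u i j ^+ 2)) ->
  O 0 (fun i => avg (fun j => @v i j ^+ 2)) ->
  O 0 (fun i => avg (fun j => @z i j ^+ 2)) ->
  O 0 (fun i => form3 (@F3 i) (@u i) (@v i) (@z i)).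
Proof.
move=> u2 v2 z2; apply: O_sqr; apply: (@O_le _ (fun i => A3 i * (
  avg (fun j => @u i j ^+ 2) * (avg (fun j => @v i j ^+ 2) *
  avg (fun j => @z i j ^+ 2))))); last by solve_bigO0.
by move=> i; rewrite ger0_norm ?sqr_ge0// form3_sqr_le.
Qed.

Let value_y : O 4 (fun i => @G i (@y i) - V i).
Proof.
have w2w : O 0 (fun i => form2 (@F2 i) (@w i) (@w i)).
  apply: O_sqr; apply: (@O_le _ (fun i => A2 i * (w2 i * w2 i))).
    by move=> i; rewrite ger0_norm ?sqr_ge0// form2_sqr_le.
  by rewrite /w2; solve_bigO0.
have ffw : O 0 (fun i => form3 (@F3 i) (@f i) (@f i) (@w i)) by exact: O_form3.
have fww : O 0 (fun i => form3 (@F3 i) (@f i) (@w i) (@w i)) by exact: O_form3.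
have www : O 0 (fun i => form3 (@F3 i) (@w i) (@w i) (@w i)) by exact: O_form3.
pose g2 i := 3 / 2 * m2c i - rho / 2 * gam i.
pose g3 i := m2a i - rho / 2 * m2b i + 1 / 6 * m3c i.
have TO : O 0 (fun i => g2 i * (2 * c i * d2 i + tau i ^+ 2) +
    g3 i * (3 * c i ^+ 2 * tau i + 3 * c i * e i * tau i ^+ 2 +
            e i ^+ 2 * tau i ^+ 3) +
    sg i ^+ 4 * (1 / 2 * form2 (@F2 i) (@w i) (@w i) +
    1 / 2 * form3 (@F3 i) (@f i) (@f i) (@w i) +
    1 / 2 * (e i * sg i) * form3 (@F3 i) (@f i) (@w i) (@w i) +
    1 / 6 * (e i * sg i) ^+ 2 * form3 (@F3 i) (@w i) (@w i) (@w i))).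
  by rewrite /g2 /g3; solve_bigO0.
apply: (bigOeM e01 TO); near=> i.
have cp : 0 < c i by near: i; exact: c_gt0.
have kp : 0 < kap i by near: i; exact: kap_gt0.
have [f0 F20] : avg (@f i) = 0 /\ forall k, avg (fun j => @F2 i j k) = 0.
  by near: i; exact: F_centered.
have [S2 S3 S3'] : [/\ forall j k, @F2 i k j = @F2 i j k,
      forall j k l, @F3 i k j l = @F3 i j k l &
      forall j k l, @F3 i j l k = @F3 i j k l] by near: i; exact: F_sym.
have E : @G i (@y i) = dta i * kap i + dta i ^+ 2 * g2 i + dta i ^+ 3 * g3 i +
  dta i ^+ 4 * (1 / 2 * form2 (@F2 i) (@w i) (@w i) +
    1 / 2 * form3 (@F3 i) (@f i) (@f i) (@w i) +
    1 / 2 * dta i * form3 (@F3 i) (@f i) (@w i) (@w i) +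
    1 / 6 * dta i ^+ 2 * form3 (@F3 i) (@w i) (@w i) (@w i)).
  exact: (candidate_value p p3 S2 S3 S3' f0 F20 (dta i) erefl).
have E2 : dta i * kap i + dta i ^+ 2 * g2 i + dta i ^+ 3 * g3 i = V i +
    e i ^+ 4 * (g2 i * (2 * c i * d2 i + tau i ^+ 2) +
    g3 i * (3 * c i ^+ 2 * tau i + 3 * c i * e i * tau i ^+ 2 +
            e i ^+ 2 * tau i ^+ 3)).
  exact: (@step_value R p p3 p4 (kap i) (gam i) (m4 i) (m2a i) (m2b i) (m2c i)
    (m3c i) (c i) (e i) (lt0r_neq0 p_gt0) (lt0r_neq0 kp) (lt0r_neq0 cp)).
rewrite E E2 (_ : V i + _ + _ - V i = e i ^+ 4 * (g2 i * (2 * c i * d2 i + tau i ^+ 2) +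
    g3 i * (3 * c i ^+ 2 * tau i + 3 * c i * e i * tau i ^+ 2 +
            e i ^+ 2 * tau i ^+ 3) +
    sg i ^+ 4 * (1 / 2 * form2 (@F2 i) (@w i) (@w i) +
    1 / 2 * form3 (@F3 i) (@f i) (@f i) (@w i) +
    1 / 2 * (e i * sg i) * form3 (@F3 i) (@f i) (@w i) (@w i) +
    1 / 6 * (e i * sg i) ^+ 2 * form3 (@F3 i) (@w i) (@w i) (@w i)))).
  by rewrite normrM ger0_norm// exprn_ge0//; case/andP: (e01 i) => /ltW.
by rewrite /dta; move: (V i) (g2 i) (g3 i) (form2 _ _ _) (form3 _ _ _ _)
  (form3 _ _ _ _) (form3 _ _ _ _) (sg i) (e i) (c i) (d2 i) (tau i) => *; ring.
Unshelve. all: by end_near. Qed.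

Let upper_bound : exists2 U : I -> R, O 4 U & \forall i \near F,
  forall L : lratio R (m i).+1, avg (fun j => phi (L j)) <= q / (2 * (m i).+1%:R) ->
  @G i (fun j => L j - 1) <= @G i (@y i) + U i.
Proof.
(* [X] is the bound of [candidate_gradient] divided by e^3. Division by 2 alpha dl contributes the
   fourth factor e, and alpha times the constraint error e^5 S is again of order e^4. *)
pose X i := 4 * e i * sg i ^+ 4 * (A2 i * w2 i) + A3 i * e i * sg i ^+ 4 * Y i ^+ 2 +
  (rho ^+ 2 + 4 * C ^+ 2 / p ^+ 2) * ck * sg i ^+ 3 * avg (@W i).
have XO : O 0 (fun i => X i * (p * sg i / (2 * dl)) + S i * (p^-1 * (sg i)^-1)).
  by rewrite /X /w2; solve_bigO0.
exists (fun i => e i ^+ 4 * (X i * (p * sg i / (2 * dl)) + S i * (p^-1 * (sg i)^-1))).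
  apply: (bigOeM e01 XO); apply: nearW => i; rewrite normrM ger0_norm//.
  by rewrite exprn_ge0//; case/andP: (e01 i) => /ltW.
have [MA MA0 bA] : exists2 MA : R, 0 < MA &
    \forall i \near F, `|1 + A2 i + A3 i + (D + 1) ^+ 2| <= MA * e i ^+ 0.
  apply: bigO_pos => //; by solve_bigO0.
have dl0 := tame_dl tphi.
(* Below this threshold for [dta], alpha = 1 / (p dta) is large enough for [weak_duality]. *)
have dMA : 0 < dl / (2 * p * MA) by rewrite divr_gt0// !mulr_gt0.
near=> i.
have /andP[d0 d1'] : 0 < dta i <= 1 by near: i; exact: dta_small.
have /andP[_ dsm] : 0 < dta i <= dl / (2 * p * MA) by near: i; exact: dta_small.
have bAi : `|1 + A2 i + A3 i + (D + 1) ^+ 2| <= MA * e i ^+ 0 by near: i; exact: bA.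
have [f0 F20] : avg (@f i) = 0 /\ forall k, avg (fun j => @F2 i j k) = 0.
  by near: i; exact: F_centered.
have [S2 S3 S3'] : [/\ forall j k, @F2 i k j = @F2 i j k,
      forall j k l, @F3 i k j l = @F3 i j k l &
      forall j k l, @F3 i j l k = @F3 i j k l] by near: i; exact: F_sym.
have df1 : forall j, dta i * `|@f i j| <= 1 by near: i; exact: df_le1.
have db1 : forall j, dta i * `|@b i j| <= 1 by near: i; exact: db_le1.
have ye : forall j, `|@y i j| <= eta by near: i; exact: y_small.
have divy : `|avg (fun j => phi (1 + @y i j)) - q / (2 * (m i).+1%:R)| <=
  e i ^+ 5 * S i by near: i; exact: divergence_y.
move=> L fL; have e0 : 0 < e i by case/andP: (e01 i).
have s0 : 0 < sg i by move: d0; rewrite /dta pmulr_rgt0.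
have pd0 : 0 < (p * dta i)^-1 by rewrite invr_gt0 mulr_gt0.
have Aal : 1 + A2 i + A3 i + (D + 1) ^+ 2 <= (p * dta i)^-1 * dl / 2.
  apply: le_trans (ler_norm _) _; apply: le_trans bAi _; rewrite expr0 mulr1.
  rewrite ler_pdivlMr// ler_pdivlMl ?mulr_gt0//.
  move: dsm; rewrite ler_pdivlMr ?mulr_gt0//.
  by apply: le_trans; rewrite le_eqVlt; apply/orP; left; apply/eqP; ring.
have H := @weak_duality R phi dphi q p p3 p4 eta C dl D q_gt0 tphi (m i) (@f i)
  (@F2 i) (@F3 i) S2 S3 S3' L (@y i) _ (- (rho / 2 * kap i * dta i)) _ _ ye
  (avg_candidate p p3 f0 F20 (dta i) erefl) pd0 (lexx _) (lexx _) Aal fL.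
apply: le_trans H _; rewrite -addrA lerD2l [leRHS]mulrDr.
have Hg := @candidate_gradient R phi dphi q p p3 p4 eta C dl D p_gt0 tphi (m i)
  (@f i) (@F2 i) (@F3 i) (kap i) (dta i).
have d01 : 0 < dta i <= 1 by rewrite d0.
have {}Hg := Hg d01 df1 db1 ye _ _ (lexx _) (lexx _).
apply: lerD; last first.
  apply: (@le_trans _ _ ((p * dta i)^-1 * (e i ^+ 5 * S i))).
    rewrite ler_wpM2l// ?(ltW pd0)//; apply: le_trans divy.
    by rewrite -normrN opprB ler_norm.
  by rewrite le_eqVlt; apply/orP; left; apply/eqP; rewrite /dta; field; rewrite !gt_eqF.
have XE : avg (fun j => (f j + op2 (@F2 i) (@y i) j +
    1 / 2 * op3 (@F3 i) (@y i) (@y i) j - (p * dta i)^-1 * dphi (1 + @y i j) -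
    - (rho / 2 * kap i * dta i)) ^+ 2) <= e i ^+ 3 * X i.
  apply: le_trans Hg _; rewrite /X -/rho -/(A2 i) -/(A3 i) -/ck -/(@W i) -/(w2 i).
  apply: (@le_trans _ _ (4 * dta i ^+ 4 * (A2 i * w2 i) +
    A3 i * (dta i ^+ 2 * Y i) ^+ 2 +
    (rho ^+ 2 + 4 * C ^+ 2 / p ^+ 2) * ck * dta i ^+ 3 * avg (@W i))).
    rewrite lerD2r lerD2l ler_wpM2l//.
      by rewrite /A3; do 3!apply: avg_ge0 => ?; exact: sqr_ge0.
    have a0 : 0 <= avg (fun j => @y i j ^+ 2).
      by apply: avg_ge0 => ?; exact: sqr_ge0.
    have b0 := le_trans a0 (y2_le d01).
    by rewrite lerXn2r ?nnegrE// y2_le.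
  by rewrite le_eqVlt; apply/orP; left; apply/eqP; rewrite /dta; ring.
have k0 : 0 <= (2 * (p * dta i)^-1 * dl)^-1.
  by rewrite invr_ge0 !mulr_ge0// ltW.
apply: le_trans (ler_wpM2r k0 XE) _.
by rewrite le_eqVlt; apply/orP; left; apply/eqP; rewrite /dta; field; rewrite !gt_eqF.
Unshelve. all: by end_near. Qed.

Let O_eM (u v : I -> R) k : O 0 (fun i => u i) ->
  (forall i, v i = e i ^+ k * u i) -> O k v.
Proof.
move=> uO vE; apply: (bigOeM e01 uO); apply: nearW => i; rewrite vE normrM.
by rewrite ger0_norm// exprn_ge0//; case/andP: (e01 i) => /ltW.
Qed.

Let lower_bound : exists2 U : I -> R, O 4 U & \forall i \near F,
  exists2 L : lratio R (m i).+1, avg (fun j => phi (L j)) <= q / (2 * (m i).+1%:R) &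
  @G i (@y i) - U i <= @G i (fun j => L j - 1).
Proof.
have [MS MS0 SM] := bigO_pos e01 SO.
(* The divergence at y is at most q / 2 e^2 + MS e^5. Multiplying by 1 - k e^3 with k q / 2 = MS
   cancels the excess and leaves - k MS e^8. *)
pose k := 2 * MS / q.
have k0 : 0 < k by rewrite divr_gt0// mulr_gt0.
have kV0 : 0 < k^-1 by rewrite invr_gt0.
pose Z i := k * sg i * ((1 + Y i * kap i) + 1 / 2 * (2 * (1 + A2 i * Y i ^+ 2)) +
  1 / 6 * (3 * (1 + A3 i * Y i ^+ 3))).
exists (fun i => e i ^+ 4 * Z i).
  by apply: (@O_eM Z) => //; rewrite /Z; solve_bigO0.
near=> i.
have d01 : 0 < dta i <= 1 by near: i; exact: dta_small.
have ek : e i <= k^-1 by near: i; exact: e_small.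
have SMi : `|S i| <= MS * e i ^+ 0 by near: i; exact: SM.
have [f0 F20] : avg (@f i) = 0 /\ forall k, avg (fun j => @F2 i j k) = 0.
  by near: i; exact: F_centered.
have [S2 S3 S3'] : [/\ forall j k, @F2 i k j = @F2 i j k,
      forall j k l, @F3 i k j l = @F3 i j k l &
      forall j k l, @F3 i j l k = @F3 i j k l] by near: i; exact: F_sym.
have ye : forall j, `|@y i j| <= eta by near: i; exact: y_small.
have divy : `|avg (fun j => phi (1 + @y i j)) - q / (2 * (m i).+1%:R)| <=
  e i ^+ 5 * S i by near: i; exact: divergence_y.
have /andP[e0 e1] := e01 i; have /andP[d0 d1'] := d01.
have s0 : 0 < sg i by move: d0; rewrite /dta pmulr_rgt0.
have e3 : e i ^+ 3 <= e i.
  by rewrite (exprS _ 2) ler_piMr ?(ltW e0)// exprn_ile1// ltW.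
have e30 : 0 <= e i ^+ 3 by rewrite exprn_ge0// ltW.
pose t := 1 - k * e i ^+ 3.
have ke3 : k * e i ^+ 3 <= 1.
  by rewrite -ler_pdivlMl// mulr1 (le_trans e3).
have t01 : 0 <= t <= 1.
  by rewrite /t subr_ge0 ke3/= lerBlDr lerDl mulr_ge0// ltW.
have /andP[t0 t1] := t01.
have yt j : 0 <= 1 + t * @y i j.
  have : `|t * @y i j| <= 1.
    rewrite normrM ger0_norm// mulr_ile1// (le_trans (ye j))// ltW//.
    by case/andP: (tame_eta tphi).
  by rewrite ler_norml; lra.
have y0 : avg (@y i) = 0 := avg_candidate p p3 f0 F20 (dta i) erefl.
have yt1 : avg (fun j => 1 + t * @y i j) = 1.
  by rewrite avgD avg_cst avgZ y0 mulr0 addr0.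
exists (LRatio yt yt1) => /=.
  apply: (@le_trans _ _ (t * avg (fun j => phi (1 + @y i j)))).
    by rewrite -avgZ; apply: ler_avg => j; have H := tame_star tphi (ye j) t01; exact: H.
  have qE : q / (2 * (m i).+1%:R) = q / 2 * e i ^+ 2.
    by rewrite e2 invfM mulrA.
  have H : avg (fun j => phi (1 + @y i j)) <= q / 2 * e i ^+ 2 + e i ^+ 5 * MS.
    rewrite -lerBlDl -qE; apply: le_trans (ler_norm _) _; apply: le_trans divy _.
    rewrite ler_wpM2l ?exprn_ge0 ?(ltW e0)//; apply: le_trans (ler_norm _) _.
    by rewrite expr0 mulr1 in SMi.
  apply: le_trans (ler_wpM2l t0 H) _; rewrite qE /t -subr_ge0.
  have -> : q / 2 * e i ^+ 2 -
      (1 - k * e i ^+ 3) * (q / 2 * e i ^+ 2 + e i ^+ 5 * MS) =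
      k * MS * e i ^+ 8 by rewrite /k; field; rewrite gt_eqF.
  apply: mulr_ge0; last by apply: exprn_ge0; exact: ltW.
  by apply: mulr_ge0; exact: ltW.
(* The null summand gives the shape of [form2_diag_lin] and [form3_diag_lin], which then yield
   homogeneity. *)
have LE : (fun j => 1 + t * @y i j - 1) = (fun j => t * @y i j + 0 * @y i j).
  by apply/funext => j; ring.
have E1 : avg (fun j => (t * @y i j + 0 * @y i j) * @f i j) =
    t * avg (fun j => @y i j * @f i j).
  by rewrite -avgZ; apply: eq_avg => j; ring.
have E2 : form2 (@F2 i) (fun j => t * @y i j + 0 * @y i j)
    (fun j => t * @y i j + 0 * @y i j) = t ^+ 2 * form2 (@F2 i) (@y i) (@y i).
  by rewrite form2_diag_lin//; ring.
have E3 : form3 (@F3 i) (fun j => t * @y i j + 0 * @y i j)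
    (fun j => t * @y i j + 0 * @y i j) (fun j => t * @y i j + 0 * @y i j) =
    t ^+ 3 * form3 (@F3 i) (@y i) (@y i) (@y i).
  by rewrite form3_diag_lin//; ring.
rewrite LE /G /cubic_expansion E1 E2 E3.
(* Again 1 + a replaces sqrt a. Each form at y is thus O(e), so shrinking by k e^3 costs O(e^4). *)
have small (x a : R) : 0 <= a -> x ^+ 2 <= dta i ^+ 2 * a -> `|x| <= dta i * (1 + a).
  move=> a0 xa; have da0 : 0 <= dta i * (1 + a).
    by apply: mulr_ge0; [exact: ltW|exact: addr_ge0].
  rewrite -(@ler_pXn2r _ 2)// real_normK ?num_real//; apply: le_trans xa _.
  by rewrite [leRHS]exprMn; apply: ler_wpM2l; [exact: sqr_ge0|have := sqr_ge0 a; nra].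
have y2 := y2_le d01; have y20 : 0 <= avg (fun j => @y i j ^+ 2).
  by apply: avg_ge0 => ?; exact: sqr_ge0.
have A20 : 0 <= A2 i by rewrite /A2; do 2!apply: avg_ge0 => ?; exact: sqr_ge0.
have A30 : 0 <= A3 i by rewrite /A3; do 3!apply: avg_ge0 => ?; exact: sqr_ge0.
have Yi := Y_ge0 i; have ki := kap_ge0 i.
have Yn n : 0 <= Y i ^+ n by exact: exprn_ge0.
have dn n : dta i ^+ n <= 1 by apply: exprn_ile1 => //; exact: ltW.
have d20 : 0 <= dta i ^+ 2 by exact: sqr_ge0.
have B1 : `|avg (fun j => @y i j * @f i j)| <= dta i * (1 + Y i * kap i).
  apply: small; first exact: mulr_ge0.
  by apply: le_trans (avg_cauchy_schwarz _ _) _; rewrite mulrA ler_wpM2r.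
have B2 : `|form2 (@F2 i) (@y i) (@y i)| <= dta i * (1 + A2 i * Y i ^+ 2).
  apply: small; first by rewrite mulr_ge0.
  apply: le_trans (form2_sqr_le _ _ _) _; rewrite -/(A2 i) -expr2.
  apply: (@le_trans _ _ (A2 i * (dta i ^+ 2 * Y i) ^+ 2)).
    by rewrite ler_wpM2l// lerXn2r ?nnegrE// mulr_ge0.
  rewrite [leLHS](_ : _ = dta i ^+ 2 * (dta i ^+ 2 * (A2 i * Y i ^+ 2))); last by ring.
  by rewrite ler_wpM2l// ler_piMl// mulr_ge0.
have B3 : `|form3 (@F3 i) (@y i) (@y i) (@y i)| <= dta i * (1 + A3 i * Y i ^+ 3).
  apply: small; first by rewrite mulr_ge0.
  apply: le_trans (form3_sqr_le _ _ _ _) _; rewrite -/(A3 i) -expr2 -exprS.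
  apply: (@le_trans _ _ (A3 i * (dta i ^+ 2 * Y i) ^+ 3)).
    by rewrite ler_wpM2l// lerXn2r ?nnegrE// mulr_ge0.
  rewrite [leLHS](_ : _ = dta i ^+ 2 * (dta i ^+ 4 * (A3 i * Y i ^+ 3))); last by ring.
  by rewrite ler_wpM2l// ler_piMl// mulr_ge0.
set X1 := avg _ in B1 *; set X2 := form2 _ _ _ in B2 *; set X3 := form3 _ _ _ _ in B3 *.
(* The factor 1 - t is taken out of 1 - t^2 and 1 - t^3; the cofactors are at most 2 and 3, the
   numbers in [Z]. *)
have -> : t * X1 + 1 / 2 * (t ^+ 2 * X2) + 1 / 6 * (t ^+ 3 * X3) =
    X1 + 1 / 2 * X2 + 1 / 6 * X3 -
    k * e i ^+ 3 * (X1 + 1 / 2 * ((1 + t) * X2) + 1 / 6 * ((1 + t + t ^+ 2) * X3)).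
  by rewrite /t; field.
rewrite lerD2l lerN2.
have -> : e i ^+ 4 * Z i = k * e i ^+ 3 * (dta i * (1 + Y i * kap i) +
    1 / 2 * (2 * (dta i * (1 + A2 i * Y i ^+ 2))) +
    1 / 6 * (3 * (dta i * (1 + A3 i * Y i ^+ 3)))).
  by rewrite /Z /dta; field.
have ke0 : 0 <= k * e i ^+ 3 by apply: mulr_ge0 => //; exact: ltW.
rewrite ler_wpM2l//.
have le_mul (a c' x z : R) : 0 <= a <= c' -> `|x| <= z -> a * x <= c' * z.
  move=> /andP[a0 ac] xz; apply: (@le_trans _ _ (a * `|x|)).
    by apply: ler_wpM2l => //; exact: ler_norm.
  by apply: ler_pM.
have t2 : t ^+ 2 <= 1 by exact: exprn_ile1.
have t20 : 0 <= t ^+ 2 by exact: sqr_ge0.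
apply: lerD; first apply: lerD.
- exact: le_trans (ler_norm _) B1.
- by rewrite ler_wpM2l//; apply: le_mul => //; lra.
- by rewrite ler_wpM2l//; apply: le_mul => //; lra.
Unshelve. all: by end_near. Qed.

Theorem optimum_expansionP : exists M : R, \forall i \near F,
  (forall L : lratio R (m i).+1, avg (fun j => phi (L j)) <= q / (2 * (m i).+1%:R) ->
     cubic_expansion (@f i) (@F2 i) (@F3 i) (fun j => L j - 1) <=
     optimum_expansion q p p3 p4 (e i) (@f i) (@F2 i) (@F3 i) + M * e i ^+ 4) /\
  (exists2 L : lratio R (m i).+1, avg (fun j => phi (L j)) <= q / (2 * (m i).+1%:R) &
     optimum_expansion q p p3 p4 (e i) (@f i) (@F2 i) (@F3 i) - M * e i ^+ 4 <=
     cubic_expansion (@f i) (@F2 i) (@F3 i) (fun j => L j - 1)).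
Proof.
have [U UO Up] := upper_bound; have [U' UO' Low] := lower_bound.
have [M M0 bM] := bigO_pos e01 UO; have [M' M0' bM'] := bigO_pos e01 UO'.
have [M1 M10 bM1] := bigO_pos e01 value_y.
exists (M1 + (M + M')); near=> i.
have H1 : `|@G i (@y i) - V i| <= M1 * e i ^+ 4 by near: i; exact: bM1.
have H2 : `|U i| <= M * e i ^+ 4 by near: i; exact: bM.
have H3 : `|U' i| <= M' * e i ^+ 4 by near: i; exact: bM'.
have e40 : 0 <= e i ^+ 4 by rewrite exprn_even_ge0.
have p1 := mulr_ge0 (ltW M0) e40; have p2 := mulr_ge0 (ltW M0') e40.
rewrite ler_norml -/(V i) in H1; case/andP: H1 => H1 H1'.
have H2' := ler_norm (U i); have H3' := ler_norm (U' i).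
split.
  have Up' : forall L : lratio R (m i).+1,
      avg (fun j => phi (L j)) <= q / (2 * (m i).+1%:R) ->
      @G i (fun j => L j - 1) <= @G i (@y i) + U i by near: i; exact: Up.
  move=> L /Up' GU; rewrite -/(@G i _) -/(V i).
  by move: (@G i _) (@G i _) (V i) H1' GU => a b' v H1' GU; lra.
have [L fL GL] : exists2 L : lratio R (m i).+1,
    avg (fun j => phi (L j)) <= q / (2 * (m i).+1%:R) &
    @G i (@y i) - U' i <= @G i (fun j => L j - 1) by near: i; exact: Low.
exists L => //; rewrite -/(@G i _) -/(V i).
by move: (@G i _) (@G i _) (V i) H1 GL => a b' v H1 GL; lra.
Unshelve. all: by end_near. Qed.

End family.

(** * Terms of the expansion *)

Section negation.
Context (R : realType) (m : nat).
Variables (f : 'I_m.+1 -> R) (F2 : 'I_m.+1 -> 'I_m.+1 -> R).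
Variable F3 : 'I_m.+1 -> 'I_m.+1 -> 'I_m.+1 -> R.
Let Nf j := - f j.
Let NF2 i j := - F2 i j.
Let NF3 i j k := - F3 i j k.

Lemma avgN (a : 'I_m.+1 -> R) : avg (fun j => - a j) = - avg a.
Proof. by rewrite -mulN1r -avgZ; apply: eq_avg => j; rewrite mulN1r. Qed.

Let op2N v j : op2 NF2 v j = - op2 F2 v j.
Proof. by rewrite -avgN; apply: eq_avg => k; rewrite /NF2 mulrN. Qed.

Let op3N u v j : op3 NF3 u v j = - op3 F3 u v j.
Proof.
rewrite -avgN; apply: eq_avg => k; rewrite -mulrN; congr (_ * _).
by rewrite -avgN; apply: eq_avg => l; rewrite /NF3 mulrN.
Qed.

Lemma cubic_expansionN v :
  cubic_expansion Nf NF2 NF3 v = - cubic_expansion f F2 F3 v.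
Proof.
have -> : cubic_expansion Nf NF2 NF3 v = - avg (fun j => v j * f j) +
    1 / 2 * (- form2 F2 v v) + 1 / 6 * (- form3 F3 v v v).
  rewrite -!avgN; congr (_ + _ * _ + _ * _); apply: eq_avg => j.
  - by rewrite /Nf mulrN.
  - by rewrite op2N mulrN.
  - by rewrite op3N mulrN.
by rewrite /cubic_expansion; ring.
Qed.

(** The function g is unchanged, being a product of two negated factors. Hence only the averages of
    f^3 and f g change sign, which flips the e^2 coefficient and preserves those of e and e^3. *)
Lemma optimum_expansionN (q p p3 p4 e : R) : optimum_expansion q p p3 p4 e Nf NF2 NF3 =
  - optimum_expansion q p p3 p4 (- e) f F2 F3.
Proof.
have sq (n : nat) : avg (fun j => Nf j ^+ n) = (-1) ^+ n * avg (fun j => f j ^+ n).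
  by rewrite -avgZ; apply: eq_avg => j; rewrite /Nf -exprMn mulN1r.
have gE j : op2 NF2 Nf j = op2 F2 f j.
  rewrite op2N -avgN; apply: eq_avg => k; rewrite /Nf; ring.
rewrite /optimum_expansion !sq (@eq_avg _ _ (fun j => op2 NF2 Nf j ^+ 2)
  (fun j => op2 F2 f j ^+ 2)); last by move=> j; rewrite gE.
rewrite (@eq_avg _ _ (fun j => Nf j ^+ 2 * op2 NF2 Nf j)
  (fun j => f j ^+ 2 * op2 F2 f j)); last by move=> j; rewrite gE /Nf sqrrN.
rewrite (@eq_avg _ _ (fun j => Nf j * op2 NF2 Nf j)
  (fun j => - (f j * op2 F2 f j))); last by move=> j; rewrite gE /Nf mulNr.
rewrite (_ : form3 NF3 Nf Nf Nf = form3 F3 f f f); last first.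
  apply: eq_avg => j; rewrite op3N /Nf mulrNN; congr (_ * _).
  apply: eq_avg => k; rewrite mulNr -mulrN; congr (_ * _).
  by rewrite -avgN; apply: eq_avg => l; rewrite /Nf; ring.
have -> : (-1) ^+ 2 = 1 :> R by ring.
have -> : (-1) ^+ 3 = - 1 :> R by ring.
have -> : (-1) ^+ 4 = 1 :> R by ring.
by rewrite avgN !mul1r; ring.
Qed.

End negation.

(** * Matching the polynomial in [e] with the stated terms *)

Section terms.
Context (R : realType) d (T : measurableType d) (m : nat) (x : 'I_m.+1 -> T).
Variables (IF1 : T -> R) (IF2 : T -> T -> R) (IF3 : T -> T -> T -> R).
Variables (phi : R -> R) (q : R).
Hypothesis q_gt0 : 0 < q.
Let p := derive1n 2 phi 1.
Let p3 := derive1n 3 phi 1.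
Let p4 := derive1n 4 phi 1.
Hypothesis p_gt0 : 0 < p.
Let f j := IF1 (x j).
Let F2 i j := IF2 (x i) (x j).
Let F3 i j k := IF3 (x i) (x j) (x k).
Hypothesis F2C : forall i j, F2 j i = F2 i j.
Hypothesis kap_gt0 : 0 < avg (fun j => f j ^+ 2).

Let e : R := Num.sqrt (m.+1%:R^-1).

Let mu2cE : mu2c x IF1 IF2 = avg (fun j => f j * op2 F2 f j).
Proof.
apply: eq_avg => i; rewrite -avgZ; apply: eq_avg => j.
by rewrite -/(f i) -/(f j) -/(F2 i j); ring.
Qed.

Let mu2bE : mu2b x IF1 IF2 = avg (fun j => f j ^+ 2 * op2 F2 f j).
Proof.
transitivity (avg (fun i => avg (fun j => f i * f j ^+ 2 * F2 i j))); first by [].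
rewrite exchange_avg; apply: eq_avg => j; rewrite -avgZ; apply: eq_avg => i.
by rewrite F2C; ring.
Qed.

Let mu2aE : mu2a x IF1 IF2 = avg (fun j => op2 F2 f j ^+ 2).
Proof.
transitivity (avg (fun i => avg (fun j => avg (fun k =>
  f i * f k * F2 i j * F2 j k)))); first by [].
(* With the middle argument outermost, the two inner averages separate into equal factors. *)
rewrite exchange_avg; apply: eq_avg => j.
rewrite expr2 -[in RHS]avgZ; apply: eq_avg => i.
rewrite [RHS]mulrC -avgZ; apply: eq_avg => k.
by rewrite (F2C j i); ring.
Qed.

Let mu3cE : mu3c x IF1 IF3 = form3 F3 f f f.
Proof.
apply: eq_avg => i; rewrite -avgZ; apply: eq_avg => j.
rewrite mulrA -avgZ; apply: eq_avg => k.
by rewrite -/(f i) -/(f j) -/(f k) -/(F3 i j k); ring.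
Qed.

Let e2 : e ^+ 2 = m.+1%:R^-1.
Proof. by rewrite sqr_sqrtr. Qed.

Let powR12 (a : R) : 0 <= a -> a `^ (1 / 2) = Num.sqrt a.
Proof. by move=> a0; rewrite div1r powR12_sqrt. Qed.

Let powR32 (a : R) : 0 <= a -> a `^ (3 / 2) = Num.sqrt a ^+ 3.
Proof.
move=> a0; rewrite (_ : 3 / 2 = 2^-1 * 3%:R); last by rewrite mulrC.
by rewrite powRrM powR12_sqrt// powR_mulrn// sqrtr_ge0.
Qed.

Let eE : e = (Num.sqrt m.+1%:R)^-1.
Proof. by rewrite /e sqrtrV. Qed.

Let t1 := term1 x IF1 phi q.
Let t2 := term2 x IF1 IF2 phi q.
Let t3 := term3 x IF1 IF2 IF3 phi q.
Let kap := avg (fun j => f j ^+ 2).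
Let c := Num.sqrt (q / (p * kap)).

Let cE : c = Num.sqrt q / (Num.sqrt p * Num.sqrt kap).
Proof.
have p0 : 0 <= p := ltW p_gt0; have k0 : 0 <= kap := ltW kap_gt0.
have pk0 : 0 <= p * kap by exact: mulr_ge0.
rewrite -(sqrtrM kap p0).
by rewrite -sqrtrV// -sqrtrM// ltW.
Qed.

Lemma term1E : t1 = e * (c * kap).
Proof.
rewrite /t1 /term1 powRN powR12// -eE; congr (_ * _).
have k0 : 0 <= kap by exact: ltW.
rewrite -[LHS]/(Num.sqrt (q * kap / p)) (sqrtrM p^-1 (mulr_ge0 (ltW q_gt0) k0)).
rewrite (sqrtrM kap (ltW q_gt0)) (sqrtrV (ltW p_gt0)) cE -{3}(sqr_sqrtr k0).
have sk : Num.sqrt kap != 0 by rewrite gt_eqF// sqrtr_gt0.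
have sp : Num.sqrt p != 0 by rewrite gt_eqF// sqrtr_gt0.
by field; rewrite sk sp.
Qed.

(** s = 1 serves the maximum and s = - 1, after [optimum_expansionN], the minimum. *)
Let terms_expansion (s : R) : s ^+ 2 = 1 ->
  optimum_expansion q p p3 p4 (s * e) f F2 F3 = s * t1 + t2 + s * t3.
Proof.
move=> s2; rewrite term1E /t2 /t3 /term2 /term3 mu2aE mu2bE mu2cE mu3cE.
have k0 : 0 <= kap by exact: ltW.
have c2 : c ^+ 2 = q / (p * kap).
  by rewrite sqr_sqrtr// divr_ge0 ?(ltW q_gt0)// mulr_ge0// ltW.
have c3 : q `^ (3 / 2) / (p `^ (3 / 2) * kap `^ (3 / 2)) = c ^+ 3.
  by rewrite !powR32 ?(ltW q_gt0) ?(ltW p_gt0)// cE exprMn exprVn exprMn.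
have e3 : m.+1%:R `^ (- (3 / 2)) = e ^+ 3 by rewrite powRN powR32// eE exprVn.
rewrite /optimum_expansion -/kap -/c.
have -> : (s * e) ^+ 2 = m.+1%:R^-1 by rewrite exprMn s2 mul1r e2.
have -> : (s * e) ^+ 3 = s * e ^+ 3 by rewrite exprMn exprSr s2 mul1r.
rewrite e3 -(mulrA (e ^+ 3)) c3 -/p -/p3 -/p4.
have -> : kappa2 x IF1 = kap by [].
have -> : gammahat x IF1 = avg (fun j => f j ^+ 3) by [].
have -> : mu4 x IF1 = avg (fun j => f j ^+ 4) by [].
by rewrite c2; ring.
Qed.

Lemma max_expansion : optimum_expansion q p p3 p4 e f F2 F3 = t1 + t2 + t3.
Proof. by have := @terms_expansion 1 (expr1n _ _); rewrite !mul1r. Qed.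

Lemma min_expansion :
  optimum_expansion q p p3 p4 e (fun j => - f j) (fun i j => - F2 i j)
    (fun i j k => - F3 i j k) = t1 - t2 + t3.
Proof.
rewrite optimum_expansionN -(mulN1r e) terms_expansion ?sqrrN ?expr1n//.
by ring.
Qed.

End terms.

(** * Optimal values and likely events *)

Section sup_inf.
Context (R : realType) (A : Type) (a : A -> R) (D : set A) (v B : R).
Local Open Scope ereal_scope.

Let abs_sub_le (s : \bar R) : (v - B)%:E <= s -> s <= (v + B)%:E ->
  `|s - v%:E| <= B%:E.
Proof.
case: s => [s| |]//; rewrite -EFinB abse_EFin !lee_fin => sv vs.
by rewrite ler_norml; apply/andP; split; lra.
Qed.

Lemma abs_sup_sub_le : (forall L, D L -> a L <= v + B)%R ->
  (exists2 L, D L & v - B <= a L)%R ->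
  `|ereal_sup [set (a L)%:E | L in D] - v%:E| <= B%:E.
Proof.
move=> ub [L DL lb]; apply: abs_sub_le.
  apply: (@le_trans _ _ (a L)%:E); first by rewrite lee_fin.
  by apply: ereal_sup_ubound; exists L.
by apply: ge_ereal_sup => _ [L' DL' <-]; rewrite lee_fin ub.
Qed.

Lemma abs_inf_sub_le : (forall L, D L -> v - B <= a L)%R ->
  (exists2 L, D L & a L <= v + B)%R ->
  `|ereal_inf [set (a L)%:E | L in D] - v%:E| <= B%:E.
Proof.
move=> lb [L DL ub]; apply: abs_sub_le.
  by apply: le_ereal_inf_tmp => _ [L' DL' <-]; rewrite lee_fin lb.
apply: (@le_trans _ _ (a L)%:E); last by rewrite lee_fin.
by apply: ereal_inf_lbound; exists L.
Qed.

End sup_inf.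

Section optimal_values.
Context (R : realType) d (T : measurableType d).
Variables (psi : probability T R -> R) (phi : R -> R) (q eta C dl D : R).
Hypotheses (q_gt0 : 0 < q) (p_gt0 : 0 < derive1n 2 phi 1).
Hypothesis tphi : tame_divergence phi (derive1 phi) q (derive1n 2 phi 1)
  (derive1n 3 phi 1) (derive1n 4 phi 1) eta C dl D.

(* The assumptions on one sample, with the stochastic bounds replaced by
   explicit ones. *)
Record good_sample (M : R) (n : nat) (x : 'I_n.+1 -> T) (IF1 : T -> R)
    (IF2 : T -> T -> R) (IF3 : T -> T -> T -> R) (rn : R) : Prop := GoodSample {
  good_remainder : `|rn| <= M * n.+1%:R ^- 2 ;
  good_expansion : forall L : lratio R n.+1,
    avg (fun i => phi (L i)) <= q / (2 * n.+1%:R) ->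
    `| psi (tiltP x L) - psi (empirical R x) -
       cubic_expansion (fun i => IF1 (x i)) (fun i j => IF2 (x i) (x j))
         (fun i j k => IF3 (x i) (x j) (x k)) (fun j => L j - 1) | <= rn ;
  good_moment1 : Ehat x (fun a => `|IF1 a| ^+ 5) <= M ;
  good_moment2 : Ehat x (fun a => Ehat x (fun b => `|IF2 a b| ^+ 5)) <= M ;
  good_moment3 : Ehat x (fun a => Ehat x (fun b => Ehat x (fun c =>
    `|IF3 a b c| ^+ 5))) <= M ;
  good_variance : ((Varhat x IF1)%:E^-1 <= M%:E)%E ;
  good_sym2 : forall i j, IF2 (x j) (x i) = IF2 (x i) (x j) ;
  good_sym12 : forall i j k, IF3 (x j) (x i) (x k) = IF3 (x i) (x j) (x k) ;
  good_sym23 : forall i j k, IF3 (x i) (x k) (x j) = IF3 (x i) (x j) (x k) ;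
  good_mean1 : Ehat x IF1 = 0 ;
  good_mean2 : forall j, Ehat x (fun k => IF2 k (x j)) = 0 }.

(** In the extended reals 0 has inverse +oo, so a finite bound on the inverse already excludes zero
    variance. *)
Lemma good_sample_variance M n (x : 'I_n.+1 -> T) IF1 IF2 IF3 rn :
  good_sample M x IF1 IF2 IF3 rn ->
  0 < avg (fun i => IF1 (x i) ^+ 2) /\ (avg (fun i => IF1 (x i) ^+ 2))^-1 <= M.
Proof.
move=> G; have := good_variance G.
have -> : Varhat x IF1 = avg (fun i => IF1 (x i) ^+ 2).
  by apply: eq_avg => i; rewrite (good_mean1 G) subr0.
have k0 : 0 <= avg (fun i => IF1 (x i) ^+ 2).
  by apply: avg_ge0 => i; exact: sqr_ge0.
rewrite inver; have [->|kN0] := eqVneq (avg _) 0; first by rewrite leye_eq.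
by rewrite lee_fin lt0r kN0 k0.
Qed.

Context (I : Type) (F : set_system I) {FF : Filter F} (m : I -> nat).
Variables (x : forall i, 'I_(m i).+1 -> T) (IF1 : I -> T -> R).
Variables (IF2 : I -> T -> T -> R) (IF3 : I -> T -> T -> T -> R) (rn : I -> R) (M : R).
Let e i : R := Num.sqrt ((m i).+1%:R^-1).
Hypothesis e_small : forall r : R, 0 < r -> \forall i \near F, e i <= r.
Hypothesis good : \forall i \near F, good_sample M (@x i) (IF1 i) (IF2 i) (IF3 i) (rn i).

Let p := derive1n 2 phi 1.
Let p3 := derive1n 3 phi 1.
Let p4 := derive1n 4 phi 1.
Let f i j := IF1 i (@x i j).
Let F2 i j k := IF2 i (@x i j) (@x i k).
Let F3 i j k l := IF3 i (@x i j) (@x i k) (@x i l).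
Let Nf i j := - @f i j.
Let NF2 i j k := - @F2 i j k.
Let NF3 i j k l := - @F3 i j k l.
Let V i := optimum_expansion q p p3 p4 (e i) (@f i) (@F2 i) (@F3 i).
Let NV i := optimum_expansion q p p3 p4 (e i) (@Nf i) (@NF2 i) (@NF3 i).

Let bounded (u : I -> R) :
  (\forall i \near F, 0 <= u i <= M) -> bigO F e 0 u.
Proof.
by move=> uM; exists M; apply: filterS uM => i /andP[u0 uM]; rewrite expr0 mulr1 ger0_norm.
Qed.

Let f5 : bigO F e 0 (fun i => avg (fun j => `|@f i j| ^+ 5)).
Proof.
apply: bounded; apply: filterS good => i G; rewrite (good_moment1 G) andbT.
by apply: avg_ge0 => j; exact: exprn_ge0.
Qed.

Let F25 : bigO F e 0 (fun i => avg (fun j => avg (fun k => `|@F2 i j k| ^+ 5))).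
Proof.
apply: bounded; apply: filterS good => i G; rewrite (good_moment2 G) andbT.
by do 2!apply: avg_ge0 => ?; exact: exprn_ge0.
Qed.

Let F35 : bigO F e 0 (fun i => avg (fun j => avg (fun k => avg (fun l =>
  `|@F3 i j k l| ^+ 5)))).
Proof.
apply: bounded; apply: filterS good => i G; rewrite (good_moment3 G) andbT.
by do 3!apply: avg_ge0 => ?; exact: exprn_ge0.
Qed.

Let kap_gt0 : \forall i \near F, 0 < avg (fun j => @f i j ^+ 2).
Proof. by apply: filterS good => i /good_sample_variance[]. Qed.

Let kapV : bigO F e 0 (fun i => (avg (fun j => @f i j ^+ 2))^-1).
Proof.
apply: bounded; apply: filterS good => i /good_sample_variance[k0 kM].
by rewrite kM andbT invr_ge0 ltW.
Qed.

Let upper_expansion : exists M' : R, \forall i \near F,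
  (forall L : lratio R (m i).+1, avg (fun j => phi (L j)) <= q / (2 * (m i).+1%:R) ->
     cubic_expansion (@f i) (@F2 i) (@F3 i) (fun j => L j - 1) <= V i + M' * e i ^+ 4) /\
  (exists2 L : lratio R (m i).+1, avg (fun j => phi (L j)) <= q / (2 * (m i).+1%:R) &
     V i - M' * e i ^+ 4 <= cubic_expansion (@f i) (@F2 i) (@F3 i) (fun j => L j - 1)).
Proof.
apply: (optimum_expansionP q_gt0 p_gt0 tphi e_small _ _ f5 F25 F35 kap_gt0 kapV).
  apply: filterS good => i G; split; [exact: good_sym2 G|exact: good_sym12 G|].
  exact: good_sym23 G.
by apply: filterS good => i G; split; [exact: good_mean1 G|exact: good_mean2 G].
Qed.

Let lower_expansion : exists M' : R, \forall i \near F,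
  (forall L : lratio R (m i).+1, avg (fun j => phi (L j)) <= q / (2 * (m i).+1%:R) ->
     cubic_expansion (@Nf i) (@NF2 i) (@NF3 i) (fun j => L j - 1) <=
     NV i + M' * e i ^+ 4) /\
  (exists2 L : lratio R (m i).+1, avg (fun j => phi (L j)) <= q / (2 * (m i).+1%:R) &
     NV i - M' * e i ^+ 4 <=
     cubic_expansion (@Nf i) (@NF2 i) (@NF3 i) (fun j => L j - 1)).
Proof.
have Nf2 i : avg (fun j => @Nf i j ^+ 2) = avg (fun j => @f i j ^+ 2).
  by apply: eq_avg => j; rewrite sqrrN.
have f5' : bigO F e 0 (fun i => avg (fun j => `|@Nf i j| ^+ 5)).
  apply: (bigO_near f5); apply: nearW => i.
  by rewrite (eq_avg (g := fun j => `|@f i j| ^+ 5))// => j; rewrite normrN.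
have F25' : bigO F e 0 (fun i => avg (fun j => avg (fun k => `|@NF2 i j k| ^+ 5))).
  apply: (bigO_near F25); apply: nearW => i.
  rewrite (eq_avg (g := fun j => avg (fun k => `|@F2 i j k| ^+ 5)))// => j.
  by apply: eq_avg => k; rewrite normrN.
have F35' : bigO F e 0 (fun i => avg (fun j => avg (fun k => avg (fun l =>
    `|@NF3 i j k l| ^+ 5)))).
  apply: (bigO_near F35); apply: nearW => i.
  rewrite (eq_avg (g := fun j => avg (fun k => avg (fun l => `|@F3 i j k l| ^+ 5))))// => j.
  by apply: eq_avg => k; apply: eq_avg => l; rewrite normrN.
have k0' : \forall i \near F, 0 < avg (fun j => @Nf i j ^+ 2).
  by apply: filterS kap_gt0 => i; rewrite Nf2.
have kV' : bigO F e 0 (fun i => (avg (fun j => @Nf i j ^+ 2))^-1).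
  by apply: (bigO_near kapV); apply: nearW => i; rewrite Nf2.
apply: (optimum_expansionP q_gt0 p_gt0 tphi e_small _ _ f5' F25' F35' k0' kV').
  apply: filterS good => i G; split => [j k|j k l|j k l]; congr (- _).
  - exact: good_sym2 G _ _.
  - exact: good_sym12 G _ _ _.
  - exact: good_sym23 G _ _ _.
apply: filterS good => i G; split=> [|k]; rewrite avgN.
  by rewrite [avg _](good_mean1 G) oppr0.
by rewrite [avg _](good_mean2 G) oppr0.
Qed.

Theorem optimal_values_expansion : exists M' : R, \forall i \near F,
  let t1 := term1 (@x i) (IF1 i) phi q in
  let t2 := term2 (@x i) (IF1 i) (IF2 i) phi q in
  let t3 := term3 (@x i) (IF1 i) (IF2 i) (IF3 i) phi q in
  let v0 := psi (empirical R (@x i)) in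
  (`|max_value (@x i) psi phi q - (v0 + t1 + t2 + t3)%:E| <=
    (M' * (m i).+1%:R ^- 2)%:E)%E /\
  (`|min_value (@x i) psi phi q - (v0 - t1 + t2 - t3)%:E| <=
    (M' * (m i).+1%:R ^- 2)%:E)%E.
Proof.
have [M1 up] := upper_expansion; have [M2 low] := lower_expansion.
have e4 i : e i ^+ 4 = (m i).+1%:R ^- 2.
  by rewrite (exprM _ 2 2) sqr_sqrtr// exprVn.
exists (`|M1| + `|M2| + M); near=> i.
have G : good_sample M (@x i) (IF1 i) (IF2 i) (IF3 i) (rn i) by near: i; exact: good.
have [up1 [Lu fLu up2]] : (forall L : lratio R (m i).+1,
     avg (fun j => phi (L j)) <= q / (2 * (m i).+1%:R) ->
     cubic_expansion (@f i) (@F2 i) (@F3 i) (fun j => L j - 1) <= V i + M1 * e i ^+ 4) /\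
  (exists2 L : lratio R (m i).+1, avg (fun j => phi (L j)) <= q / (2 * (m i).+1%:R) &
     V i - M1 * e i ^+ 4 <= cubic_expansion (@f i) (@F2 i) (@F3 i) (fun j => L j - 1)).
  by near: i; exact: up.
have [lo1 [Ll fLl lo2]] : (forall L : lratio R (m i).+1,
     avg (fun j => phi (L j)) <= q / (2 * (m i).+1%:R) ->
     cubic_expansion (@Nf i) (@NF2 i) (@NF3 i) (fun j => L j - 1) <=
     NV i + M2 * e i ^+ 4) /\
  (exists2 L : lratio R (m i).+1, avg (fun j => phi (L j)) <= q / (2 * (m i).+1%:R) &
     NV i - M2 * e i ^+ 4 <=
     cubic_expansion (@Nf i) (@NF2 i) (@NF3 i) (fun j => L j - 1)).
  by near: i; exact: low.
pose t1 := term1 (@x i) (IF1 i) phi q.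
pose t2 := term2 (@x i) (IF1 i) (IF2 i) phi q.
pose t3 := term3 (@x i) (IF1 i) (IF2 i) (IF3 i) phi q.
pose v0 := psi (empirical R (@x i)).
have [k0 _] := good_sample_variance G.
have VE : V i = t1 + t2 + t3 by exact: (max_expansion _ q_gt0 p_gt0 (good_sym2 G) k0).
have NVE : NV i = t1 - t2 + t3.
  exact: (min_expansion _ q_gt0 p_gt0 (good_sym2 G) k0).
rewrite VE e4 in up1 up2; rewrite NVE e4 in lo1 lo2.
set r : R := (m i).+1%:R ^- 2 in up1 up2 lo1 lo2 *.
have r0 : 0 <= r by rewrite invr_ge0 exprn_ge0.
have rM : `|rn i| <= M * r by exact: good_remainder G.
have M1r : M1 * r <= `|M1| * r by rewrite ler_wpM2r// ler_norm.
have M2r : M2 * r <= `|M2| * r by rewrite ler_wpM2r// ler_norm.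
have n1 : 0 <= `|M1| * r by rewrite mulr_ge0.
have n2 : 0 <= `|M2| * r by rewrite mulr_ge0.
have A1 (L : lratio R (m i).+1) : feasible phi q L ->
    - (M * r) <= psi (tiltP (@x i) L) - v0 -
      cubic_expansion (@f i) (@F2 i) (@F3 i) (fun j => L j - 1) <= M * r.
  move=> fL; rewrite -ler_norml; apply: le_trans rM.
  by apply: le_trans (ler_norm _); exact: good_expansion G L fL.
have NG v : cubic_expansion (@Nf i) (@NF2 i) (@NF3 i) v =
  - cubic_expansion (@f i) (@F2 i) (@F3 i) v by exact: cubic_expansionN.
split.
  apply: (@abs_sup_sub_le _ _ (fun L => psi (tiltP (@x i) L)) (feasible phi q)
    (v0 + t1 + t2 + t3) ((`|M1| + `|M2| + M) * r)) => [L fL|].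
    by have := up1 L fL; case/andP: (A1 L fL); lra.
  by exists Lu => //; case/andP: (A1 Lu fLu); move: up2; lra.
apply: (@abs_inf_sub_le _ _ (fun L => psi (tiltP (@x i) L)) (feasible phi q)
  (v0 - t1 + t2 - t3) ((`|M1| + `|M2| + M) * r)) => [L fL|].
  by have := lo1 L fL; rewrite NG; case/andP: (A1 L fL); lra.
by exists Ll => //; case/andP: (A1 Ll fLl); move: lo2; rewrite NG; lra.
Unshelve. all: by end_near. Qed.

End optimal_values.

(** * Stochastic orders as uniform bounds on likely events *)

Section likely_events.
Context d (Omega : measurableType d) (R : realType) (P : probability Omega R).
Implicit Types (Q : nat -> set Omega) (Y : nat -> Omega -> \bar R) (r : nat -> R).

Definition likely (e : R) Q := \forall n \near \oo, ((P^*)%mu (~` Q n) <= e%:E)%E.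

Lemma likelyI a b Q Q' : likely a Q -> likely b Q' ->
  likely (a + b) (fun n => Q n `&` Q' n).
Proof.
move=> lQ lQ'; apply: filterS2 lQ lQ' => n Qa Q'b; rewrite setCI EFinD.
by apply: le_trans (outer_measureU2 _ _ _) _; exact: leeD.
Qed.

Lemma likely_ae Q : (forall n, \forall w \ae P, Q n w) -> likely 0 Q.
Proof.
move=> aeQ; apply: nearW => n; have [A [mA PA QA]] := aeQ n.
apply: (@le_trans _ _ ((P^*)%mu A)); first exact: le_outer_measure.
by move/eqP: PA; rewrite eq_le => /andP[PA _]; rewrite measurable_mu_extE.
Qed.

Lemma bigOp_likely Y r : bigOp P Y r -> forall e : R, 0 < e ->
  exists M : R, likely e (fun n => [set w | (`|Y n w| <= (M * r n)%:E)%E]).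
Proof.
move=> Yr e e0; have [M YM] := Yr e e0; exists M; apply: filterS YM => n.
apply: le_trans; apply: le_outer_measure => w /= /negP.
by rewrite -ltNge.
Qed.

Lemma likely_bigOp Y r : (forall e : R, 0 < e -> exists M : R, exists2 Q, likely e Q &
    \forall n \near \oo, forall w, Q n w -> (`|Y n w| <= (M * r n)%:E)%E) ->
  bigOp P Y r.
Proof.
move=> H e e0; have [M [Q lQ QY]] := H e e0; exists M.
apply: filterS2 lQ QY => n lQ QY; apply: le_trans lQ.
apply: le_outer_measure => w /= Yw Qw.
by have := lt_le_trans Yw (QY w Qw); rewrite ltxx.
Qed.

(** A constant obtained along this filter is independent of the sample point, as [bigOp] demands.
    The filter is improper when the events are empty, hence only [Filter] is claimed. *)
Definition uniformly_on Q : set_system (nat * Omega) :=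
  fun A => \forall n \near \oo, forall w, Q n w -> A (n, w).

Lemma uniformly_on_filter Q : Filter (uniformly_on Q).
Proof.
split; first by apply: nearW.
- rewrite /uniformly_on => A B QA QB.
  apply: filterS2 QA QB => n QA QB w Qw.
  by split; [exact: QA|exact: QB].
- rewrite /uniformly_on => A B AB QA.
  by near=> n => w Qw; apply: AB; move: w Qw; near: n.
Unshelve. all: by end_near. Qed.

End likely_events.

Unset Implicit Arguments.

Theorem theorem3 (d d' : measure_display) (Omega : measurableType d)
    (T : measurableType d') (R : realType) (P : probability Omega R)
    (P0 : probability T R) (X : nat -> {RV P >-> T}) (iidX : iid P0 X)
    (psi : probability T R -> R) (phi : R -> R) (q : R) (q_gt0 : 0 < q)
    (IF1 : probability T R -> T -> R)
    (IF2 : probability T R -> T -> T -> R)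
    (IF3 : probability T R -> T -> T -> T -> R)
    (Rn : nat -> Omega -> R) (c0 C0 delta0 : R) :
  let N (n : nat) : R := n.+1%:R in
  let x (n : nat) (w : Omega) : 'I_n.+1 -> T := fun i => X i w in
  let Phat n w : probability T R := empirical R (x n w) in
  let F1 n w := IF1 (Phat n w) in
  let F2 n w := IF2 (Phat n w) in
  let F3 n w := IF3 (Phat n w) in
  let E n w : (T -> R) -> R := Ehat (x n w) in
  let ED n w : lratio R n.+1 -> (T -> R) -> R := Edelta (x n w) in
  (* (A) *)
  bigOp P (fun n w => (Rn n w)%:E) (fun n => N n ^- 2) ->
  (* (A1) *)
  (forall n, \forall w \ae P, forall L : lratio R n.+1,
     avg (fun i => phi (L i)) <= q / (2 * N n) ->
     `| psi (tiltP (x n w) L) - psi (Phat n w)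
        - (ED n w L (F1 n w)
           + 1 / 2 * ED n w L (fun a => ED n w L (fun b => F2 n w a b))
           + 1 / 6 * ED n w L (fun a => ED n w L (fun b => ED n w L (fun c =>
                       F3 n w a b c)))) | <= Rn n w) ->
  (* (A2) *)
  (forall m : nat, (1 <= m <= 5)%N ->
     [/\ bigOp P (fun n w => (E n w (fun a => `|F1 n w a| ^+ m))%:E)
           (fun=> 1),
         bigOp P (fun n w => (E n w (fun a => E n w (fun b =>
                    `|F2 n w a b| ^+ m)))%:E) (fun=> 1) &
         bigOp P (fun n w => (E n w (fun a => E n w (fun b => E n w (fun c =>
                    `|F3 n w a b c| ^+ m))))%:E) (fun=> 1)]) ->
  bigOp P (fun n w => ((Varhat (x n w) (F1 n w))%:E^-1)%E) (fun=> 1) ->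
  (* (A3) *)
  (forall n, \forall w \ae P, forall i j k : 'I_n.+1,
     let a := x n w i in let b := x n w j in let c := x n w k in
     F2 n w b a = F2 n w a b /\
     [/\ F3 n w a c b = F3 n w a b c,
         F3 n w b a c = F3 n w a b c,
         F3 n w b c a = F3 n w a b c,
         F3 n w c a b = F3 n w a b c &
         F3 n w c b a = F3 n w a b c]) ->
  (forall n, \forall w \ae P, forall i j : 'I_n.+1,
     let a := x n w i in let b := x n w j in
     [/\ E n w (F1 n w) = 0,
         E n w (fun k => F2 n w k a) = 0 /\
         E n w (fun k => F2 n w a k) = 0,
         E n w (fun k => F3 n w k a b) = 0,
         E n w (fun k => F3 n w a k b) = 0 &
         E n w (fun k => F3 n w a b k) = 0]) ->
  (* (B) *)
  convex_function (E := R^o) `[0, +oo[%classic phi ->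
  phi 1 = 0 -> derive1 phi 1 = 0 -> 0 < derive1n 2 phi 1 ->
  (forall k : nat, (k < 5)%N -> forall y : R, 0 < y ->
     derivable (derive1n k phi) y 1) ->
  (forall y : R, 0 < y -> {for y, continuous (derive1n 5 phi)}) ->
  0 < delta0 ->
  [set y | 0 <= y /\ phi y <= q / 2] = `[c0, C0]%classic ->
  (forall y : R, c0 <= y <= C0 -> 0 < y -> delta0 < derive1n 2 phi y) ->
  let t1 n w := term1 (x n w) (F1 n w) phi q in
  let t2 n w := term2 (x n w) (F1 n w) (F2 n w) phi q in
  let t3 n w := term3 (x n w) (F1 n w) (F2 n w) (F3 n w) phi q in
  bigOp P (fun n w => max_value (x n w) psi phi q
             - (psi (Phat n w) + t1 n w + t2 n w + t3 n w)%:E)%E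
    (fun n => N n ^- 2) /\
  bigOp P (fun n w => min_value (x n w) psi phi q
             - (psi (Phat n w) - t1 n w + t2 n w - t3 n w)%:E)%E
    (fun n => N n ^- 2).
Proof.
move=> N x Phat F1 F2 F3 E ED hRn hA1 hA2 hV hS hC cvx phi1 dphi1 p_gt0 dphi
  cphi5 delta0_gt0 range phi2 t1 t2 t3.
have [eta [C [D tphi]]] := tame_divergenceP q_gt0 cvx phi1 dphi1 dphi
  (cphi5 1 ltr01) delta0_gt0 range phi2.
have key (e : R) : 0 < e -> exists M : R, exists2 Q, likely P e Q &
  \forall n \near \oo, forall w, Q n w ->
    (`|max_value (x n w) psi phi q
       - (psi (Phat n w) + t1 n w + t2 n w + t3 n w)%:E| <= (M * N n ^- 2)%:E)%E /\
    (`|min_value (x n w) psi phi q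
       - (psi (Phat n w) - t1 n w + t2 n w - t3 n w)%:E| <= (M * N n ^- 2)%:E)%E.
  (* Five stochastic bounds share the tolerance: the remainder, three moments and the inverse
     variance. The almost sure conditions cost 0. *)
  move=> e0; have e5 : 0 < e / 5 by rewrite divr_gt0.
  have [h1 h2 h3] := hA2 5%N isT.
  have [M0 L0] := bigOp_likely hRn e5; have [M1 L1] := bigOp_likely h1 e5.
  have [M2 L2] := bigOp_likely h2 e5; have [M3 L3] := bigOp_likely h3 e5.
  have [M4 L4] := bigOp_likely hV e5.
  have L := likelyI L0 (likelyI L1 (likelyI L2 (likelyI L3 (likelyI L4 (likelyI
    (likely_ae hA1) (likelyI (likely_ae hS) (likely_ae hC))))))).
  set Q := (fun n => _) in L.
  have {}L : likely P e Q by move: L; congr likely; lra.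
  (* Absolute values, since nothing is known about the signs of the constants supplied by
     [bigOp]. *)
  pose M := `|M0| + `|M1| + `|M2| + `|M3| + `|M4|.
  have FQ : Filter (uniformly_on Q) := uniformly_on_filter Q.
  have e_small : forall r : R, 0 < r -> \forall i \near uniformly_on Q,
      Num.sqrt (i.1.+1%:R^-1) <= r.
    move=> r r0; near_simpl; rewrite /uniformly_on.
    have r2 : 0 < r ^+ 2 by rewrite exprn_gt0.
    have := near_infty_natSinv_lt (PosNum r2); apply: filterS => n /= nr w _.
    rewrite -(@ler_pXn2r _ 2)// ?nnegrE ?sqrtr_ge0 ?(ltW r0)// sqr_sqrtr//.
    exact: ltW.
  have good : \forall i \near uniformly_on Q,
      good_sample psi phi q M (x i.1 i.2) (F1 i.1 i.2) (F2 i.1 i.2) (F3 i.1 i.2)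
        (Rn i.1 i.2).
    rewrite nearE /uniformly_on; apply: nearW => n w.
    move=> [/= q0 [q1 [q2 [q3 [q4 [a1 [a2 a3]]]]]]].
    have MM : [/\ M0 <= M, M1 <= M, M2 <= M, M3 <= M & M4 <= M].
      have := (normr_ge0 M0, normr_ge0 M1, normr_ge0 M2, normr_ge0 M3, normr_ge0 M4).
      have := (ler_norm M0, ler_norm M1, ler_norm M2, ler_norm M3, ler_norm M4).
      by rewrite /M => -[[[[? ?] ?] ?] ?] [[[[? ?] ?] ?] ?]; split; lra.
    case: MM => MM0 MM1 MM2 MM3 MM4.
    have leM (a b : R) : (`|a%:E| <= (b * 1)%:E)%E -> b <= M -> a <= M.
      rewrite abse_EFin lee_fin mulr1 => ab bM.
      exact: le_trans (le_trans (ler_norm a) ab) bM.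
    split.
    - rewrite lee_fin in q0; apply: le_trans q0 _.
      by rewrite ler_wpM2r// invr_ge0 exprn_ge0.
    - exact: a1.
    - exact: leM q1 MM1.
    - exact: leM q2 MM2.
    - exact: leM q3 MM3.
    - apply: le_trans (lee_abs _) _; apply: le_trans q4 _.
      by rewrite lee_fin mulr1.
    - by move=> i j; have [] := a2 i j i.
    - by move=> i j k; have [_ []] := a2 i j k.
    - by move=> i j k; have [_ []] := a2 i j k.
    - by have [] := a3 ord0 ord0.
    - by move=> j; have [_ []] := a3 j j.
  have [M' vals] := optimal_values_expansion q_gt0 p_gt0 tphi e_small good.
  by exists M', Q.
split; apply: likely_bigOp => e /key[M [Q lQ QM]]; exists M, Q => //;
  by apply: filterS QM => n QM w /QM[].
Qed.
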